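(* Let $H$ be a finite simple graph that contains a connected induced subgraph $C$ having neither a cut vertex nor a nonadjacent two-vertex cut. Suppose $H$ has an edge $e_0$ such that $H-e_0$ is $C$-free. Then $H$ has a finite addition host.
   Context: All graphs are simple, undirected and finite. $H-e_0$ is $H$ with the edge $e_0$ deleted (vertices kept). ''$C$-free'' means containing no induced subgraph isomorphic to $C$. A vertex cut of a connected graph is a set of vertices whose removal leaves at least two nonempty components; a cut vertex is a vertex forming a one-element vertex cut; a nonadjacent two-vertex cut is a vertex cut consisting of two distinct nonadjacent vertices. A finite addition host for $H$ is a finite non-complete graph $J$ that contains no induced subgraph isomorphic to $H$ and such that, for every nonedge $f$ of $J$ (unordered pair of distinct nonadjacent vertices), the graph $J+f$ contains an induced subgraph isomorphic to $H$. *)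

(* Defs.v *)
From mathcomp Require Import all_boot.
Set Implicit Arguments.
Unset Strict Implicit.
Unset Printing Implicit Defensive.

Record sgraph := SGraph {
  vertex :> finType;
  adj : rel vertex;
  adj_sym : symmetric adj;
  adj_irrefl : irreflexive adj }.

Definition complete (G : sgraph) : Prop :=
  forall x y : G, x != y -> adj x y.

Section Constructions.
Variable G : sgraph.

Section Induced.
Variable S : {set G}.

Definition induced_adj : rel {x : G | x \in S} :=
  fun x y => adj (val x) (val y).

Lemma induced_sym : symmetric induced_adj.
Proof. by move=> x y; rewrite /induced_adj adj_sym. Qed.

Lemma induced_irrefl : irreflexive induced_adj.
Proof. by move=> x; rewrite /induced_adj adj_irrefl. Qed.

Definition induced : sgraph := SGraph induced_sym induced_irrefl.
End Induced.

Section EdgeChange.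
Variables u v : G.

Definition del_edge_adj : rel G :=
  fun x y => adj x y && ([set x; y] != [set u; v]).

Lemma del_edge_sym : symmetric del_edge_adj.
Proof. by move=> x y; rewrite /del_edge_adj adj_sym setUC. Qed.

Lemma del_edge_irrefl : irreflexive del_edge_adj.
Proof. by move=> x; rewrite /del_edge_adj adj_irrefl. Qed.

Definition del_edge : sgraph := SGraph del_edge_sym del_edge_irrefl.

(* The test x != y only matters when u = v, in which case no edge is added. *)
Definition add_edge_adj : rel G :=
  fun x y => adj x y || (x != y) && ([set x; y] == [set u; v]).

Lemma add_edge_sym : symmetric add_edge_adj.
Proof. by move=> x y; rewrite /add_edge_adj adj_sym setUC eq_sym. Qed.

Lemma add_edge_irrefl : irreflexive add_edge_adj.
Proof. by move=> x; rewrite /add_edge_adj adj_irrefl eqxx. Qed.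

Definition add_edge : sgraph := SGraph add_edge_sym add_edge_irrefl.
End EdgeChange.
End Constructions.

Definition isomorphic (G1 G2 : sgraph) : Prop :=
  exists2 f : G1 -> G2, bijective f & forall x y, adj (f x) (f y) = adj x y.

Definition contains_induced (F G : sgraph) : Prop :=
  exists S : {set G}, isomorphic F (induced S).

(* The graph without vertices is not connected. *)
Definition connected (G : sgraph) : Prop :=
  0 < #|G| /\ forall x y : G, connect (@adj G) x y.

Definition nb_components (G : sgraph) : nat := n_comp (@adj G) G.

Definition vertex_cut (G : sgraph) (S : {set G}) : Prop :=
  2 <= nb_components (induced (~: S)).

Definition has_cut_vertex (G : sgraph) : Prop :=
  exists x : G, vertex_cut [set x].

Definition has_nonadjacent_two_cut (G : sgraph) : Prop :=
  exists x y : G, [/\ x != y, ~~ adj x y & vertex_cut [set x; y]].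

Definition addition_host (H J : sgraph) : Prop :=
  [/\ ~ complete J,
      ~ contains_induced H J
    & forall u v : J, u != v -> ~~ adj u v ->
        contains_induced H (add_edge u v)].

(* Main.v *)
From HB Require Import structures.
Require Import Defs.
From mathcomp Require Import all_boot.
From mathcomp Require Import all_fingroup zmodp cyclic.
Set Implicit Arguments.
Unset Strict Implicit.
Unset Printing Implicit Defensive.
Import GroupScope.

(* Write F = H - e0 with e0 = ab. It suffices to find a finite C-free graph G,
   a union of induced copies of F called blocks, such that every nonedge of a
   block is the pair ab of some block. Call these nonedges kept. Adding to G,
   as long as no induced H appears, nonedges that are not kept ends with a
   host: a kept nonedge always completes its block to an induced H, and every
   other one completes an H by maximality.

   The graph G is a coset graph. Colours form a finite graph R in which every
   nonedge (between distinct H-coordinates) is the pair ab of an induced F;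
   there is one generator for each such nonedge, and it permutes cyclically
   the copies of F in R that contain it. The vertices of colour c are the
   cosets of the subgroup generated by the nonedges at c, and each group
   element carries one block. Two cosets of adjacent colours then meet in at
   most one element, two cosets of distinct colours in a coset of a cyclic
   group generated by one letter. If the group has no short nondegenerate
   cycles of cosets, as in Otto's acyclic groups, a copy of C not contained in
   one block is separated by one vertex or by two nonadjacent vertices.

   The acyclic group is built in two steps. A group that is universal for
   actions on small sets is free up to a given length with respect to single
   letters. The second group acts moreover on chains of copies of the first
   one, which unfold the cycles of cosets, and such chains create no new
   relation between the letters at one colour. *)

(** * Groups generated by letters *)

Section Words.
Variables (E : finType) (gT : finGroupType) (t : E -> gT).

Definition ev (w : seq E) : gT := \prod_(e <- w) t e.

Lemma ev_nil : ev [::] = 1. Proof. exact: big_nil. Qed.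
Lemma ev_cons e w : ev (e :: w) = t e * ev w. Proof. exact: big_cons. Qed.
Lemma ev_cat w1 w2 : ev (w1 ++ w2) = ev w1 * ev w2.
Proof. exact: big_cat. Qed.
Lemma ev_nseq e n : ev (nseq n e) = t e ^+ n.
Proof. by elim: n => [|n IHn]; rewrite ?ev_nil // ev_cons IHn expgS. Qed.

Definition gen (B : {set E}) := <<[set t e | e in B]>>%G.

(** In a finite group inverses are powers, so words without inverse letters reach the whole
    subgroup. *)
Lemma genP (B : {set E}) x :
  reflect (exists2 w, {subset w <= B} & x = ev w) (x \in gen B).
Proof.
apply: (iffP idP) => [/gen_prodgP [n [c cB ->]]|[w wB ->]].
  have pre i : exists2 e, e \in B & c i = t e by exact/imsetP/cB.
  have [n0|n_gt0] := posnP n.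
    exists [::]; first by [].
    by subst n; rewrite big_ord0 ev_nil.
  have [e0 _ _] := pre (Ordinal n_gt0).
  pose f i := odflt e0 [pick e in B | c i == t e].
  have fP i : f i \in B /\ c i = t (f i).
    rewrite /f; case: pickP => [e /andP[eB /eqP]|no] //=.
    by have [e eB ce] := pre i; have := no e; rewrite eB ce eqxx.
  exists [seq f i | i <- index_enum (ordinal n)].
    by move=> _ /mapP[i _ ->]; case: (fP i).
  by rewrite /ev big_map; apply: eq_bigr => i _; exact: (fP i).2.
elim: w wB => [|e w IHw] wB; first by rewrite ev_nil group1.
rewrite ev_cons groupM ?IHw // => [|e' e'w].
  by apply/mem_gen/imset_f/wB; rewrite inE eqxx.
by apply: wB; rewrite inE e'w orbT.
Qed.

Lemma gen_letter (B : {set E}) e : e \in B -> t e \in gen B.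
Proof. by move=> eB; apply/mem_gen/imset_f. Qed.

Lemma gen_sub (B B' : {set E}) : B \subset B' -> gen B \subset gen B'.
Proof. by move=> sBB'; apply/genS/imsetS. Qed.

Lemma gen_empty : gen set0 = 1%G.
Proof. by apply/val_inj; rewrite /= imset0 gen0. Qed.

Lemma gen_sub_cycle (B : {set E}) (e : E) : {in B, forall e', e' = e} -> gen B \subset <[t e]>.
Proof.
move=> Be; rewrite gen_subG; apply/subsetP=> _ /imsetP[e' /Be -> ->].
exact: cycle_id.
Qed.

End Words.

(** * A group universal for actions on small sets *)

Section SmallActions.
Variables (E : finType) (o M : nat).

(* All actions of the letters on 'I_M.+1 at once: a relation holds in the group
   generated by the permutations below iff it holds in every action on at most
   M + 1 points in which each letter has order dividing o. *)
Definition small_action : finType := ({ffun E -> {perm 'I_M.+1}} * 'I_M.+1)%type.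

Definition bounded (h : {ffun E -> {perm 'I_M.+1}}) := [forall e, h e ^+ o == 1].

Definition small_step e (x : small_action) : small_action :=
  (x.1, if bounded x.1 then x.1 e x.2 else x.2).

Lemma small_step_inj e : injective (small_step e).
Proof.
move=> [h i] [h' i'] [/= <-]; case: ifP => _; last by move->.
by move/perm_inj->.
Qed.

Definition small_letter e : {perm small_action} := perm (@small_step_inj e).

Lemma ev_small_letter w h i : bounded h -> ev small_letter w (h, i) = (h, ev h w i).
Proof.
move=> bh; elim: w i => [|e w IHw] i; first by rewrite !ev_nil !perm1.
by rewrite !ev_cons !permM permE /small_step /= bh IHw.
Qed.

Lemma ev_small_letter_bad w h i : ~~ bounded h -> ev small_letter w (h, i) = (h, i).
Proof.
move=> /negbTE bh; elim: w => [|e w IHw]; first by rewrite !ev_nil !perm1.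
by rewrite !ev_cons !permM permE /small_step /= bh IHw.
Qed.

Lemma small_letter_order e : small_letter e ^+ o = 1.
Proof.
apply/permP=> -[h i]; rewrite -ev_nseq perm1.
have [bh|bh] := boolP (bounded h); last by rewrite ev_small_letter_bad.
by rewrite ev_small_letter // ev_nseq (eqP (forallP bh e)) perm1.
Qed.

(** Letting the letters outside [B] act trivially turns a bounded action into another bounded
    action; there a word acts as its part over [B] does in the original one. *)
Lemma small_retract (B : {set E}) w w' :
  ev small_letter w = ev small_letter w' ->
  ev small_letter [seq e <- w | e \in B] = ev small_letter [seq e <- w' | e \in B].
Proof.
move=> eww; apply/permP=> -[h i].
have [bh|bh] := boolP (bounded h); last by rewrite !ev_small_letter_bad.
pose h' := [ffun e => if e \in B then h e else 1].
have bh' : bounded h'.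
  by apply/forallP=> e; rewrite ffunE; case: ifP; rewrite ?expg1n ?(forallP bh e).
have evh' u : ev h [seq e <- u | e \in B] = ev h' u.
  elim: u => [|e u IHu]; first by rewrite !ev_nil.
  by rewrite ev_cons -IHu ffunE /=; case: ifP => _; rewrite ?ev_cons ?mul1g.
rewrite !ev_small_letter // !evh'; congr (_, _).
by have := congr1 (fun s : {perm _} => (s (h', i)).2) eww; rewrite /= !ev_small_letter.
Qed.

(** Retracting to [B] fixes a word over [B] and leaves of a word over [B'] only letters of both
    sets. *)
Lemma gen_small_cap (B B' : {set E}) :
  gen small_letter B :&: gen small_letter B' \subset gen small_letter (B :&: B').
Proof.
apply/subsetP=> x /setIP[/genP[w wB ->] /genP[w' w'B' eww]].
have := small_retract B eww; have -> : [seq e <- w | e \in B] = w.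
  by apply/all_filterP/allP.
move=> ->; apply/genP; exists [seq e <- w' | e \in B] => // e.
by rewrite mem_filter inE => /andP[-> /w'B'].
Qed.

(** Numbering the points of [O] and fixing all other indices gives one of the bounded actions. Only
    [O] has to be small, not [Y]: this is applied to a small stable set inside a large chain. *)
Lemma small_universal (Y : finType) (f : E -> {perm Y}) (O : {set Y}) (B : {set E}) w :
  #|O| <= M.+1 ->
  {in B & O, forall e y, f e y \in O} ->
  {in B & O, forall e y, (f e ^+ o) y = y} ->
  {subset w <= B} -> ev small_letter w = 1 -> {in O, forall y, ev f w y = y}.
Proof.
move=> leOM stO ordO wB w1 y0 y0O.
pose pt (i : 'I_M.+1) := nth y0 (enum O) i.
pose ix y : 'I_M.+1 := inord (index y (enum O)).
have ixK : {in O, cancel ix pt}.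
  move=> y yO; rewrite /pt /ix inordK ?nth_index ?mem_enum //.
  by rewrite (leq_trans _ leOM) // cardE index_mem mem_enum.
have ptO (i : 'I_M.+1) : i < #|O| -> pt i \in O.
  by move=> iO; rewrite -mem_enum mem_nth // -cardE.
have ptK (i : 'I_M.+1) : i < #|O| -> ix (pt i) = i.
  move=> iO; rewrite /ix /pt index_uniq ?enum_uniq -?cardE //.
  by rewrite inord_val.
have ltix y : y \in O -> (ix y < #|O|)%N.
  move=> yO; rewrite /ix inordK; first by rewrite cardE index_mem mem_enum.
  by rewrite (leq_trans _ leOM) // cardE index_mem mem_enum.
pose hf e (i : 'I_M.+1) := if (e \in B) && (i < #|O|) then ix (f e (pt i)) else i.
have hf_lt e i : (hf e i < #|O|) = (i < #|O|).
  rewrite /hf; case: ifP => // /andP[eB iO].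
  by rewrite iO ltix // stO // ptO.
have hf_inj e : injective (hf e).
  move=> i j eij; have ijO : (i < #|O|) = (j < #|O|) by rewrite -(hf_lt e i) eij hf_lt.
  move: eij; rewrite /hf -ijO; case: ifP => // /andP[eB iO].
  have jO : j < #|O| by rewrite -ijO.
  move=> /(congr1 pt); rewrite !ixK ?stO ?ptO // => /perm_inj.
  by move=> /(congr1 ix); rewrite !ptK.
pose h := [ffun e => perm (@hf_inj e)].
have hE e y : e \in B -> y \in O -> h e (ix y) = ix (f e y).
  by move=> eB yO; rewrite ffunE permE /hf eB ltix //= ixK.
have hX e y n : e \in B -> y \in O -> (h e ^+ n) (ix y) = ix ((f e ^+ n) y) /\ (f e ^+ n) y \in O.
  move=> eB yO; elim: n => [|n [IHn IHO]]; first by rewrite !expg0 !perm1.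
  by rewrite !expgSr !permM IHn hE // stO.
have bh : bounded h.
  apply/forallP=> e; apply/eqP/permP=> i; rewrite perm1.
  have [/andP[eB iO]|out] := boolP ((e \in B) && (i < #|O|)).
    by rewrite -[i in LHS]ptK // (hX _ _ _ eB (ptO _ iO)).1 ordO ?ptO // ptK.
  have fixi : h e i = i by rewrite ffunE permE /hf (negbTE out).
  by elim: o => [|n IHn]; rewrite ?expg0 ?perm1 // expgSr permM IHn.
have evE u y : {subset u <= B} -> y \in O -> ev h u (ix y) = ix (ev f u y) /\ ev f u y \in O.
  elim: u y => [|e u IHu] y uB yO; first by rewrite !ev_nil !perm1.
  have eB : e \in B by apply: uB; rewrite inE eqxx.
  rewrite !ev_cons !permM hE //; apply: IHu; last exact: stO.
  by move=> e' e'u; apply: uB; rewrite inE e'u orbT.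
have := ev_small_letter w (ix y0) bh; rewrite w1 perm1 => -[].
have [-> evO] := evE w y0 wB y0O.
by move=> /(congr1 pt); rewrite !ixK.
Qed.

End SmallActions.

(** * Chains of hubs *)

Section Chain.
Variables (E : finType) (gT : finGroupType) (t : E -> gT) (N m : nat).
Variables (A : nat -> {set E}) (d : nat -> gT).
Hypothesis m_le : m <= N.+1.

(* Hub i is a copy of gT on which only the letters of A i act. The coset
   d i * glue i of hub i is identified with the subgroup glue i of hub i.+1;
   a point of this overlap is represented in hub i.+1, so pairs (i, z) with
   exits i z are junk fixed by every letter. *)
Definition glue i := gen t (A i :&: A i.+1).

(* The two overlaps of an inner hub are disjoint: no point lies in three hubs. *)
Hypothesis nondeg : forall i, 0 < i -> i.+1 < m -> d i \notin glue i.-1 * glue i.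

Definition exits i (z : gT) := (i.+1 < m) && ((d i)^-1 * z \in glue i).
Definition hub_point i z : 'I_N.+1 * gT :=
  if exits i z then (inord i.+1, (d i)^-1 * z) else (inord i, z).

(** The factor [u] is separate from [e] so that [u = (t e)^-1] gives the inverse map. The third
    branch serves points of an overlap, which are represented in hub [i] although [e] may act only
    on hub [i.-1]. *)
Definition step e (u : gT) (y : 'I_N.+1 * gT) :=
  let: (i, z) := y in
  if exits i z then y
  else if e \in A i then hub_point i (z * u)
  else if [&& 0 < i, i < m, z \in glue i.-1 & e \in A i.-1]
    then hub_point i.-1 (d i.-1 * z * u)
  else y.

(** A point of both overlaps would write [d i.+1] as a product from [glue i] and [glue i.+1]. *)
Lemma face_not_exits i z : i.+1 < m -> z \in glue i -> exits i.+1 z = false.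
Proof.
move=> im zi; apply/negP=> /andP[im2 dz].
have /negP[] := nondeg (ltn0Sn i) im2; apply/mulsgP.
exists z ((((d i.+1)^-1 * z))^-1); rewrite ?groupV //=.
by rewrite invMg invgK mulKVg.
Qed.

Lemma hub_exits i z : exits i z -> hub_point i z = (inord i.+1, (d i)^-1 * z).
Proof. by rewrite /hub_point => ->. Qed.

Lemma hub_stays i z : exits i z = false -> hub_point i z = (inord i, z).
Proof. by rewrite /hub_point => ->. Qed.

Lemma hub_back i z : i.+1 < m -> z \in glue i -> hub_point i (d i * z) = hub_point i.+1 z.
Proof.
move=> im zi; have ex : exits i (d i * z) by rewrite /exits im mulKg.
by rewrite hub_exits // mulKg hub_stays // face_not_exits.
Qed.

(** The condition under which multiplication by [u] agrees in two glued hubs on which [e] acts. *)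
Definition admissible e u := forall i, e \in A i -> e \in A i.+1 -> u \in glue i.

Lemma letter_admissible e : admissible e (t e).
Proof. by move=> i eA eA'; apply: gen_letter; rewrite inE eA. Qed.

(** The step does not depend on the hub in which a point is represented: if [e] acts on both hubs of
    an overlap, [u] keeps the point in the overlap. *)
Lemma hub_step e u i z : admissible e u -> i <= N -> e \in A i ->
  step e u (hub_point i z) = hub_point i (z * u).
Proof.
move=> adm iN eA; have [ex|nex] := boolP (exits i z); last first.
  by rewrite hub_stays ?(negbTE nex) // /step inordK ?ltnS // (negbTE nex) eA.
have /andP[im zi] := ex; have iN1 : i.+1 < N.+1 by apply: leq_trans m_le.
rewrite hub_exits // /step inordK // face_not_exits //.
rewrite /= im zi eA mulKVg; case: ifP => [eA'|neA'] //.
have zui : (d i)^-1 * z * u \in glue i by rewrite groupM // adm.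
by rewrite -hub_back // !mulgA mulgV mul1g.
Qed.

Lemma hubP e (y : 'I_N.+1 * gT) :
  (exists i z, [/\ i <= N, e \in A i & y = hub_point i z]) \/ forall u, step e u y = y.
Proof.
case: y => i z; rewrite /step.
have [ex|/negbTE nex] := boolP (exits i z); first by right.
have [eA|neA] := boolP (e \in A i).
  by left; exists i, z; rewrite -ltnS ltn_ord hub_stays // inord_val.
case: (boolP [&& _, _, _ & _]) => [/and4P[i0 im zi eA]|_]; last by right.
left; exists i.-1, (d i.-1 * z); split => //.
  by rewrite -ltnS prednK // ltnW // ltn_ord.
by rewrite hub_back ?prednK // hub_stays // inord_val.
Qed.

Lemma stepK e : cancel (step e (t e)) (step e (t e)^-1).
Proof.
move=> y; have [[i [z [iN eA ->]]]|fixy] := hubP e y; last by rewrite !fixy.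
rewrite !hub_step ?mulgK //; last exact: letter_admissible.
by move=> j eAj eAj'; rewrite groupV letter_admissible.
Qed.

Definition chain_letter e := perm (can_inj (stepK e)).

Lemma chain_letter_hub e i z : i <= N -> e \in A i ->
  chain_letter e (hub_point i z) = hub_point i (z * t e).
Proof. by move=> iN eA; rewrite permE hub_step //; apply: letter_admissible. Qed.

Lemma ev_chain_letter_hub w i z : i <= N -> {subset w <= A i} ->
  ev chain_letter w (hub_point i z) = hub_point i (z * ev t w).
Proof.
move=> iN; elim: w z => [|e w IHw] z wA; first by rewrite !ev_nil perm1 mulg1.
rewrite !ev_cons permM chain_letter_hub ?wA ?mem_head // IHw ?mulgA // => e' e'w.
by rewrite wA // inE e'w orbT.
Qed.

Lemma chain_letter_order e o : t e ^+ o = 1 -> chain_letter e ^+ o = 1.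
Proof.
move=> to1; apply/permP=> y; rewrite perm1.
have [[i [z [iN eA ->]]]|fixy] := hubP e y.
  rewrite -ev_nseq ev_chain_letter_hub // ?ev_nseq ?to1 ?mulg1 //.
  by move=> e'; rewrite mem_nseq => /andP[_ /eqP->].
elim: (o) => [|n IHn]; first by rewrite expg0 perm1.
by rewrite expgSr permM IHn permE fixy.
Qed.

Lemma hub_next i : i.+1 < m -> hub_point i (d i) = hub_point i.+1 1.
Proof. by move=> im; rewrite -hub_back ?group1 // mulg1. Qed.

(** Each segment leads from 1 to [d i] in hub [i], and [d i] is glued to the point 1 of the next
    hub. *)
Lemma ev_chain_letter_walk (ws : nat -> seq E) k : k < m ->
  (forall i, i < m -> {subset ws i <= A i}) ->
  (forall i, i < m -> ev t (ws i) = d i) ->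
  ev chain_letter (flatten [seq ws i | i <- iota 0 k.+1]) (hub_point 0 1) = hub_point k (d k).
Proof.
move=> km wsA wsd; elim: k km => [|k IHk] km.
  by rewrite /= cats0 (ev_chain_letter_hub _ _ (wsA _ km)) ?mul1g ?wsd.
have -> : iota 0 k.+2 = iota 0 k.+1 ++ [:: k.+1] by rewrite -[k.+2]addn1 iotaD.
rewrite map_cat flatten_cat ev_cat permM (IHk (ltnW km)) (hub_next km).
have kN : k.+1 <= N by rewrite -ltnS (leq_trans km).
by rewrite /= cats0 (ev_chain_letter_hub _ kN (wsA _ km)) mul1g wsd.
Qed.

End Chain.

(** * Freeness up to a given length with respect to single letters *)

Section FreeProduct.
Variables (E : finType) (o' K M : nat).
Notation o := o'.+1.
Hypothesis leM : (K.+1 * o <= M.+1)%N.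
Notation small_letter := (@small_letter E o M).

(** The hubs are cyclic groups of order [o], one per factor, each with a single acting letter.
    Consecutive letters differ, so hubs are glued at single points, and the product moves the
    initial point along the chain without returning. The chain has [K.+1 * o] points, few enough for
    [small_universal]. *)
Lemma small_free_powers (L : seq (E * nat)) : 0 < size L -> size L <= K.+1 ->
  {in L, forall p, small_letter p.1 ^+ p.2 != 1} -> sorted (fun p q => p.1 != q.1) L ->
  \prod_(p <- L) small_letter p.1 ^+ p.2 != 1.
Proof.
case: L => // p0 L0; set L := p0 :: L0 => _ szL ntL srtL.
pose e i := (nth p0 L i).1; pose a i := (nth p0 L i).2.
pose t0 (_ : E) : 'I_o := Zp1; pose d i : 'I_o := Zp1 ^+ a i.
pose A i : {set E} := [set e i].
have faceE i : i.+1 < size L -> glue t0 A i = 1 :> {set 'I_o}.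
  move=> iL; rewrite /glue; suff -> : A i :&: A i.+1 = set0 by rewrite gen_empty.
  apply/setP=> x; rewrite !inE; apply/negbTE/andP=> -[/eqP-> /eqP eqe].
  have := sortedP p0 srtL _ iL; rewrite -/(e i) -/(e i.+1) eqe eqxx; exact/negP.
have dN1 i : i < size L -> d i != 1.
  move=> iL; apply: contraNneq (ntL (nth p0 L i) (mem_nth _ iL)) => di1.
  have : #[Zp1 : 'I_o] %| a i by rewrite order_dvdn -/(d i) di1.
  rewrite -[(nth p0 L i).2]/(a i) order_Zp1 => /dvdnP[k ->].
  by rewrite mulnC expgM small_letter_order expg1n.
have nondeg i : 0 < i -> i.+1 < size L -> d i \notin glue t0 A i.-1 * glue t0 A i.
  move=> i0 iL; rewrite !faceE ?prednK ?(ltnW iL) // mulg1 inE dN1 //.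
  exact: ltnW.
have Wt : \prod_(p <- L) small_letter p.1 ^+ p.2 =
    ev small_letter (flatten [seq nseq p.2 p.1 | p <- L]).
  elim: L {szL ntL srtL e a d A faceE dN1 nondeg} => [|p L IHL].
    by rewrite big_nil ev_nil.
  by rewrite big_cons IHL /= ev_cat ev_nseq.
pose ws i := nseq (a i) (e i).
have wsE : flatten [seq nseq p.2 p.1 | p <- L] = flatten [seq ws i | i <- iota 0 (size L)].
  by rewrite -{1}(mkseq_nth p0 L) /mkseq -map_comp.
apply/eqP; rewrite Wt wsE => W1.
pose tc := chain_letter szL nondeg.
have tc1 : ev tc (flatten [seq ws i | i <- iota 0 (size L)])
    (hub_point t0 K (size L) A d 0 1) = hub_point t0 K (size L) A d 0 1.
  apply: (@small_universal E o M _ tc setT setT _ _ _ _ _ W1) => //.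
    by rewrite cardsT card_prod !card_ord.
  move=> x y _ _; rewrite chain_letter_order ?perm1 //.
  by apply/eqP; rewrite -order_dvdn order_Zp1.
have wsA i : i < size L -> {subset ws i <= A i}.
  by move=> _ x; rewrite mem_nseq inE => /andP[].
have wsd i : i < size L -> ev t0 (ws i) = d i by rewrite ev_nseq.
have := ev_chain_letter_walk szL nondeg (k := size L0) (leqnn _) wsA wsd.
rewrite -/tc tc1 hub_stays; last first.
  rewrite /exits; apply/negbTE/negP => /andP[sz1].
  by rewrite faceE // mulg1 inE invg_eq1; apply/negP/dN1.
rewrite hub_stays => [[/(congr1 val)]|]; last by rewrite /exits ltnn.
rewrite /= !inordK //; move=> sz0 d1.
by have := dN1 (size L0) (leqnn _); rewrite -d1 eqxx.
Qed.

Lemma small_free_product (L : seq (E * {perm small_action E M})) :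
  0 < size L -> size L <= K.+1 ->
  {in L, forall p, (p.2 \in <[small_letter p.1]>) && (p.2 != 1)} ->
  sorted (fun p q => p.1 != q.1) L ->
  \prod_(p <- L) p.2 != 1.
Proof.
move=> L0 LK LP srtL.
have [L' L'E] : exists L' : seq (E * nat), L = [seq (p.1, small_letter p.1 ^+ p.2) | p <- L'].
  elim: L {L0 LK srtL} LP => [|[e g] L IHL] LP; first by exists [::].
  have [p pL|L' ->] := IHL; first by rewrite LP // inE pL orbT.
  have /andP[/cycleP[a /= ->] _] := LP (e, g) (mem_head _ _).
  by exists ((e, a) :: L').
subst L; rewrite big_map; apply: small_free_powers; rewrite ?size_map in L0 LK * => //.
  by move=> p pL; have /andP[] := LP _ (map_f _ pL).
by rewrite sorted_map in srtL.
Qed.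

End FreeProduct.

(* A family T of subsets of the hubs that agrees on the overlaps. *)
Section Thread.
Variables (E : finType) (gT : finGroupType) (t : E -> gT) (N m : nat).
Variables (A : nat -> {set E}) (d : nat -> gT).
Hypothesis m_le : m <= N.+1.
Hypothesis nondeg : forall i, 0 < i -> i.+1 < m -> d i \notin glue t A i.-1 * glue t A i.
Notation hub := (hub_point t N m A d).
Notation face := (glue t A).

Lemma hub_eq i j u z : i <= N -> j <= N -> hub i u = hub j z ->
  [\/ i = j /\ u = z,
      [/\ i.+1 = j, j < m, z \in face i & u = d i * z] |
      [/\ j.+1 = i, i < m, u \in face j & z = d j * u]].
Proof.
move=> iN jN; rewrite /hub_point; case: ifPn => [/andP[im ui]|_]; case: ifPn => [/andP[jm zj]|_].
- case=> /(congr1 val) /=; rewrite !inordK ?(leq_trans im) ?(leq_trans jm) //.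
  by case=> eij; rewrite eij => /mulgI->; constructor 1.
- case=> /(congr1 val) /=; rewrite !inordK ?(leq_trans im) // => eij <-.
  by constructor 2; rewrite mulKVg -eij.
- case=> /(congr1 val) /=; rewrite !inordK ?(leq_trans jm) // => -> ->.
  by constructor 3; rewrite mulKVg.
- case=> /(congr1 val) /=; rewrite !inordK // => -> ->; by constructor 1.
Qed.

Variables (D : {set E}) (T : nat -> {set gT}).
Hypothesis T_closed :
  forall j u e, j <= N -> u \in T j -> e \in D -> e \in A j -> u * t e \in T j.
Hypothesis T_match :
  forall j u, j.+1 < m -> u \in face j -> (d j * u \in T j) = (u \in T j.+1).

Definition thread := \bigcup_(j < N.+1) [set hub j u | u in T j].

Lemma thread_hub i u : i <= N -> (hub i u \in thread) = (u \in T i).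
Proof.
move=> iN; apply/bigcupP/idP => [[[j jN] _ /imsetP[z zT /hub_eq]]|uT]; last first.
  by exists (Ordinal (iN : i < N.+1)); rewrite ?imset_f.
case=> // [[-> ->] //|[eij jm zi ->]|[eji im uj ezu]]; rewrite /= in zT.
  by rewrite T_match ?eij.
by rewrite -eji -T_match ?eji // -ezu.
Qed.

Lemma thread_stable : {in D & thread, forall e y, chain_letter m_le nondeg e y \in thread}.
Proof.
move=> e y eD yT; have [[i [z [iN eA yE]]]|fixy] := hubP nondeg e y.
  subst y; rewrite chain_letter_hub // thread_hub // T_closed //.
  by rewrite thread_hub in yT.
by rewrite permE fixy.
Qed.

Lemma card_thread b : (forall j, j <= N -> #|T j| <= b) -> (#|thread| <= N.+1 * b)%N.
Proof.
move=> leb; suff : (#|thread| <= \sum_(j < N.+1) b)%N by rewrite sum_nat_const card_ord.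
rewrite /thread.
elim/big_ind2: _ => [|U1 n1 U2 n2 le1 le2|j _]; first by rewrite cards0.
  by rewrite (leq_trans (leq_card_setU _ _)) ?leq_add.
by rewrite (leq_trans (leq_imset_card _ _)) // leb // -ltnS.
Qed.

End Thread.

Lemma card_mulg_le (gT : finGroupType) (U V : {set gT}) : #|U * V| <= (#|U| * #|V|)%N.
Proof.
by rewrite -cardsX -[U * V]/(mulg @2: (U, V)) curry_imset2X leq_imset_card.
Qed.

Lemma set0_mulg (gT : finGroupType) (V : {set gT}) : set0 * V = set0.
Proof. by apply/setP=> g; rewrite inE; apply/mulsgP=> -[u v]; rewrite inE. Qed.

Lemma mulg_set0 (gT : finGroupType) (U : {set gT}) : U * set0 = set0.
Proof. by apply/setP=> g; rewrite inE; apply/mulsgP=> -[u v]; rewrite inE. Qed.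

(** Used with an overlap as [G] and a branch as [H]: closing a set under the branch adds no point of
    the overlap. *)
Lemma mulg_cap (gT : finGroupType) (U : {set gT}) (G H : {group gT}) :
  U \subset G -> H :&: G \subset (1 : {set gT}) -> U * H :&: G \subset U.
Proof.
move=> UG tiHG; apply/subsetP=> _ /setIP[/mulsgP[u h uU hH ->] uhG].
suff /eqP-> : h == 1 by rewrite mulg1.
rewrite -in_set1 (subsetP tiHG) // inE hH /=.
by rewrite -(mulKg u h) groupM ?groupV // (subsetP UG).
Qed.

(** * Chains respect the relations between the letters at one colour *)

Section Domination.
Variables (Q E : finType) (EQ : Q -> {set E}).
Hypothesis EQ_line : forall c c' e e', c != c' -> e \in EQ c -> e \in EQ c' ->
  e' \in EQ c -> e' \in EQ c' -> e' = e.
Hypothesis EQ_simple : forall x c c', x != c -> x != c' -> c != c' ->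
  EQ x :&: EQ c :&: EQ c' = set0.
Variables (o' N M : nat).
Notation o := o'.+1.
Hypothesis leM : (N.+1 * o ^ N.+1 <= M.+1)%N.
Notation small_group := {perm small_action E M}.
Notation small_letter := (@small_letter E o M).
Variables (c : nat -> Q) (d : nat -> small_group) (m : nat).
Hypothesis m_le : m <= N.+1.
Hypothesis c_dist : forall i, i.+1 < m -> c i != c i.+1.
Notation A := (fun i => EQ (c i)).
Notation face := (glue small_letter A).
Hypothesis nondeg : forall i, 0 < i -> i.+1 < m -> d i \notin face i.-1 * face i.
Notation hub := (hub_point small_letter N m A d).

(* The orbit of the point (i0, z0) under the letters at x, when it avoids the
   hubs of colour x: in each other hub only one letter at x acts, so the orbit
   lies in one strand whose size is bounded independently of small_group. *)
Section OneColour.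
Variable x : Q.
Definition branch j := gen small_letter (EQ x :&: A j).

(** Distinct colours share at most one letter, so the branch is trivial or lies in the cyclic group
    of that letter. *)
Lemma card_branch j : c j != x -> #|branch j| <= o.
Proof.
move=> cjx; have [E0|[e]] := set_0Vmem (EQ x :&: A j).
  by rewrite /branch E0 gen_empty cards1.
rewrite inE => /andP[ex ej]; apply: (@leq_trans #|<[small_letter e]>|).
  apply/subset_leq_card/gen_sub_cycle => e'; rewrite inE => /andP[ex' ej'].
  exact: EQ_line cjx ej ex ej' ex'.
by rewrite -orderE dvdn_leq // order_dvdn small_letter_order.
Qed.

(** A letter common to both groups would lie at three distinct colours. *)
Lemma branch_face_next j : j.+1 < m -> x != c j -> x != c j.+1 ->
  branch j.+1 :&: face j \subset (1 : {set small_group}).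
Proof.
move=> jm xj xj1; rewrite (subset_trans (gen_small_cap _ _ _ _)) //.
suff -> : EQ x :&: A j.+1 :&: (A j :&: A j.+1) = set0 by rewrite gen_empty.
apply/setP=> e; have := EQ_simple xj xj1 (c_dist jm); move/setP/(_ e).
by rewrite !inE; case: (e \in EQ x); case: (e \in EQ (c j)); case: (e \in EQ (c j.+1)).
Qed.

Lemma branch_face j : j.+1 < m -> x != c j -> x != c j.+1 ->
  branch j :&: face j \subset (1 : {set small_group}).
Proof.
move=> jm xj xj1; rewrite (subset_trans (gen_small_cap _ _ _ _)) //.
suff -> : EQ x :&: A j :&: (A j :&: A j.+1) = set0 by rewrite gen_empty.
apply/setP=> e; have := EQ_simple xj xj1 (c_dist jm); move/setP/(_ e).
by rewrite !inE; case: (e \in EQ x); case: (e \in EQ (c j)); case: (e \in EQ (c j.+1)).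
Qed.

Variables (i0 : nat) (z0 : small_group).
Hypotheses (i0N : i0 <= N) (xi0 : x != c i0) (z0_stays : exits small_letter m A d i0 z0 = false).
Hypothesis z0_entry : 0 < i0 -> i0 < m -> z0 \in face i0.-1 -> x != c i0.-1.

(** The part of the strand in hub [i0 + k]: the points entering through the overlap with the
    preceding hub, closed under the letters at [x] acting here. [down] does the same towards hub
    0. *)
Fixpoint up k : {set small_group} :=
  if k is k'.+1 then
    if i0 + k < m then ((d (i0 + k'))^-1 *: up k' :&: face (i0 + k')) * branch (i0 + k)
    else set0
  else z0 *: branch i0.

Fixpoint down k : {set small_group} :=
  if k is k'.+1 then
    if (k <= i0) && (i0 < m)
    then (d (i0 - k) *: (down k' :&: face (i0 - k))) * branch (i0 - k)
    else set0
  else z0 *: branch i0.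

Lemma up0 : up 0 = z0 *: branch i0. Proof. by []. Qed.
Lemma upS k : i0 + k.+1 < m -> up k.+1 =
  ((d (i0 + k))^-1 *: up k :&: face (i0 + k)) * branch (i0 + k.+1).
Proof. by rewrite /up => ->. Qed.

Lemma down0 : down 0 = z0 *: branch i0. Proof. by []. Qed.
Lemma downS k : k < i0 -> i0 < m -> down k.+1 =
  (d (i0 - k.+1) *: (down k :&: face (i0 - k.+1))) * branch (i0 - k.+1).
Proof. by rewrite /down => -> ->. Qed.

(** Just before a hub of colour [x] the branch equals the face. A strand entering that hub would
    then place [z0] in the overlap, against [z0_stays], or write an inner [d] as a product from two
    faces, against [nondeg]. *)
Lemma up_empty k : 0 < k -> c (i0 + k) = x -> up k = set0.
Proof.
case: k => // k _ ckx; have [km|] := boolP (i0 + k.+1 < m); last by move/negbTE=> /= ->.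
rewrite upS //; rewrite addnS in ckx km *.
suff -> : (d (i0 + k))^-1 *: up k :&: face (i0 + k) = set0 by rewrite set0_mulg.
apply/setP=> f; rewrite [RHS]inE; apply/setIP=> -[]; rewrite mem_lcoset invgK => uT fF.
have brE : branch (i0 + k) = face (i0 + k) by rewrite /branch /glue /= ckx setIC.
case: k => [|k] in ckx km brE uT fF *.
  rewrite addn0 in ckx km brE uT fF *.
  rewrite up0 mem_lcoset brE in uT; move/negP: z0_stays; apply.
  rewrite /exits km -groupV invMg invgK.
  by have := groupM uT (groupVr fF); rewrite mulgA mulgK.
rewrite upS in uT; last by rewrite (leq_trans _ km).
rewrite brE addnS in uT; rewrite addnS in ckx km brE fF.
case/mulsgP: uT => s g /setIP[_ sF] gF /(canRL (mulgK _)) dE.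
have /negP[] := nondeg (ltn0Sn (i0 + k)) km; rewrite dE -mulgA mem_mulg //.
by rewrite groupM ?groupV.
Qed.

(** As for [up_empty], with [z0_entry] in place of [z0_stays]. *)
Lemma down_empty k : 0 < k -> k <= i0 -> c (i0 - k) = x -> down k = set0.
Proof.
case: k => // k _ ki0 ckx; have [i0m|] := boolP (i0 < m); last first.
  by move/negbTE=> /= ->; rewrite andbF.
rewrite downS //; suff -> : down k :&: face (i0 - k.+1) = set0.
  by rewrite mulg_set0 set0_mulg.
have ejk : (i0 - k.+1).+1 = i0 - k by rewrite -subSn // subSS.
have brE : branch (i0 - k) = face (i0 - k.+1) by rewrite /branch /glue /= ckx ejk.
apply/setP=> f; rewrite [RHS]inE; apply/setIP=> -[uT fF].
case: k => [|k] in ki0 ckx ejk brE uT fF *.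
  rewrite subn0 in ejk brE; rewrite down0 mem_lcoset brE in uT.
  have := z0_entry ki0 i0m; rewrite -subn1 ckx eqxx => noent; apply/notF/noent.
  by have := groupM uT (groupVr fF); rewrite mulgK groupV.
rewrite downS ?(ltnW ki0) // brE in uT.
case/mulsgP: uT => _ g /lcosetP[s /setIP[_ sF] ->] gF fE.
have jm : (i0 - k.+1).+1 < m.
  by rewrite -subSn ?subSS ?(leq_ltn_trans (leq_subr _ _)) // ltnW.
have j0 : 0 < i0 - k.+1 by rewrite subn_gt0.
have /negP[] := nondeg j0 jm.
have -> : (i0 - k.+1).-1 = i0 - k.+2 by rewrite -ejk.
have -> : d (i0 - k.+1) = (f * g^-1) * s^-1 by rewrite fE !mulgK.
by rewrite mem_mulg ?groupM ?groupV.
Qed.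

Definition strand j := if i0 <= j then up (j - i0) else down (i0 - j).

Lemma up_closed k u e : u \in up k -> e \in EQ x -> e \in A (i0 + k) -> u * small_letter e \in up k.
Proof.
move=> uT ex eA; have tb : small_letter e \in branch (i0 + k) by apply: gen_letter; rewrite inE ex.
case: k => [|k] in uT eA tb *.
  rewrite addn0 in tb; rewrite up0 mem_lcoset in uT.
  by rewrite up0 mem_lcoset mulgA groupM.
have [km|] := boolP (i0 + k.+1 < m); last by move/negbTE=> km; rewrite /= km inE in uT.
rewrite upS // in uT; rewrite upS //; case/mulsgP: uT => s b sS bB ->.
by rewrite -mulgA mem_mulg // groupM.
Qed.

Lemma down_closed k u e : k <= i0 -> u \in down k -> e \in EQ x -> e \in A (i0 - k) ->
  u * small_letter e \in down k.
Proof.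
move=> ki uT ex eA.
have tb : small_letter e \in branch (i0 - k) by apply: gen_letter; rewrite inE ex.
case: k => [|k] in ki uT eA tb *.
  rewrite subn0 in tb; rewrite down0 mem_lcoset in uT.
  by rewrite down0 mem_lcoset mulgA groupM.
have [i0m|] := boolP (i0 < m); last first.
  by move/negbTE=> im; rewrite /= im andbF inE in uT.
rewrite downS // in uT; rewrite downS //; case/mulsgP: uT => s b sS bB ->.
by rewrite -mulgA mem_mulg // groupM.
Qed.

Lemma strand_closed j u e :
  u \in strand j -> e \in EQ x -> e \in A j -> u * small_letter e \in strand j.
Proof.
rewrite /strand; case: leqP => [ij|ji] uT ex eA.
  by apply: up_closed; rewrite ?subnKC.
by apply: down_closed; rewrite ?leq_subr ?subKn ?(ltnW ji).
Qed.

(** Off colour [x] the branch meets the face only in 1, so the closure under it creates no further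
    point of the overlap. If one of the two hubs has colour [x], no point of the strand crosses the
    overlap. *)
Lemma strand_match j u : j.+1 < m -> u \in face j ->
  (d j * u \in strand j) = (u \in strand j.+1).
Proof.
move=> jm uF; rewrite /strand; case: (leqP i0 j) => [ij|ji].
  rewrite (leq_trans ij (leqnSn _)) subSn //; set k := j - i0.
  have jE : j = i0 + k by rewrite subnKC.
  have km : i0 + k.+1 < m by rewrite addnS -jE.
  have uS : (u \in (d j)^-1 *: up k :&: face j) = (d j * u \in up k).
    by rewrite inE mem_lcoset invgK uF andbT.
  rewrite upS // -jE addnS -jE; set S := _ :&: _ in uS *.
  apply/idP/idP => [|uSB]; first by rewrite -uS => uS1; rewrite -[u]mulg1 mem_mulg ?group1.
  have [xj1|xj1] := eqVneq x (c j.+1).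
    have := up_empty (ltn0Sn k); rewrite addnS -jE => /(_ (esym xj1)).
    by rewrite upS // -jE addnS -jE => US0; rewrite US0 inE in uSB.
  have [xj|xj] := eqVneq x (c j).
    have k0 : 0 < k by rewrite lt0n; apply: contraNneq xi0 => k0; rewrite xj jE k0 addn0.
    have S0 : S = set0.
      apply/setP=> f; rewrite [RHS]inE [LHS]inE; apply/andP=> -[].
      by rewrite up_empty -?jE // mulg_set0 inE.
    by rewrite S0 set0_mulg inE in uSB.
  have SF : S \subset face j by apply: subsetIr.
  rewrite -uS; apply: (subsetP (mulg_cap SF (branch_face_next jm xj xj1))).
  by apply/setIP.
set k := (i0 - j).-1; have kE : i0 - j = k.+1 by rewrite prednK // subn_gt0.
have ki : k < i0 by rewrite -kE leq_subr.
have jE : j = i0 - k.+1 by rewrite -kE subKn // ltnW.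
have j1E : j.+1 = i0 - k by rewrite jE -subSn // subSS.
have -> : (if i0 <= j.+1 then up (j.+1 - i0) else down (i0 - j.+1)) = down k.
  case: leqP => [ij|_]; last by rewrite {1}j1E subKn // ltnW.
  have ej : i0 = j.+1 by apply/eqP; rewrite eqn_leq ij.
  have k0 : k = 0 by rewrite /k ej subSnn.
  by rewrite [in up _]ej subnn k0.
rewrite kE; have [i0m|i0m] := boolP (i0 < m); last first.
  have -> : down k.+1 = set0 by rewrite /= (negbTE i0m) andbF.
  suff -> : down k = set0 by rewrite !inE.
  case: k => [|k'] in kE ki jE j1E *; last by rewrite /= (negbTE i0m) andbF.
  by move: i0m; rewrite -[i0]subn0 -j1E jm.
rewrite downS // -jE; apply/idP/idP => [dSB|uD]; last first.
  by rewrite -[d j * u]mulg1 !mem_mulg ?group1 // ?inE ?uD.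
have [xj|xj] := eqVneq x (c j).
  have := down_empty (ltn0Sn k) ki; rewrite -jE => /(_ (esym xj)).
  by rewrite downS // -jE => DS0; rewrite DS0 inE in dSB.
have [xj1|xj1] := eqVneq x (c j.+1).
  have k0 : 0 < k by rewrite lt0n; apply: contraNneq xi0 => k0; rewrite xj1 j1E k0 subn0.
  have D0 : down k = set0 by apply: down_empty; rewrite -?j1E // ltnW.
  by rewrite D0 set0I mulg_set0 set0_mulg inE in dSB.
case/mulsgP: dSB => _ b /lcosetP[s sS ->] bB; rewrite -mulgA => /mulgI uE.
have usB : u \in (down k :&: face j) * branch j :&: face j.
  by rewrite inE uF andbT uE mem_mulg.
have := subsetP (mulg_cap (subsetIr _ _) (branch_face jm xj xj1)) _ usB.
by rewrite inE => /andP[].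
Qed.

(** The bound on the branch fails at colour [x], but there the strand is empty. *)
Lemma card_branch_le j (U : {set small_group}) n : #|U| <= o ^ n ->
  (c j = x -> U * branch j = set0) -> #|U * branch j| <= o ^ n.+1.
Proof.
move=> leU Ux; have [cjx|cjx] := eqVneq (c j) x; first by rewrite Ux // cards0.
rewrite (leq_trans (card_mulg_le _ _)) // expnSr leq_mul //.
exact: card_branch.
Qed.

Lemma card_up k : #|up k| <= o ^ k.+1.
Proof.
elim: k => [|k IHk].
  rewrite up0; apply: card_branch_le => [|cx]; first by rewrite cards1.
  by have := xi0; rewrite cx eqxx.
have [km|] := boolP (i0 + k.+1 < m); last by move/negbTE=> /= ->; rewrite cards0.
rewrite upS //; apply: card_branch_le => [|cx]; last by rewrite -upS ?up_empty.
by rewrite (leq_trans (subset_leq_card (subsetIl _ _))) // card_lcoset.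
Qed.

Lemma card_down k : #|down k| <= o ^ k.+1.
Proof.
elim: k => [|k IHk].
  rewrite down0; apply: card_branch_le => [|cx]; first by rewrite cards1.
  by have := xi0; rewrite cx eqxx.
have [/andP[ki i0m]|] := boolP ((k < i0) && (i0 < m)); last first.
  by move/negbTE=> /= ->; rewrite cards0.
rewrite downS //; apply: card_branch_le => [|cx]; last by rewrite -downS ?down_empty.
by rewrite card_lcoset (leq_trans (subset_leq_card (subsetIl _ _))).
Qed.

Lemma card_strand j : j <= N -> #|strand j| <= o ^ N.+1.
Proof.
move=> jN; rewrite /strand; case: ifP => _.
  by rewrite (leq_trans (card_up _)) // leq_pexp2l // ltnS (leq_trans (leq_subr _ _)).
by rewrite (leq_trans (card_down _)) // leq_pexp2l // ltnS (leq_trans (leq_subr _ _)).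
Qed.

End OneColour.

(** In a hub of colour [x] the word multiplies by its value 1. Any other point lies in a thread of
    at most [N.+1 * o ^ N.+1] points, to which [small_universal] applies. *)
Lemma chain_dominated x w : {subset w <= EQ x} -> ev small_letter w = 1 ->
  ev (chain_letter m_le nondeg) w = 1.
Proof.
move=> wx w1; apply/permP=> y; rewrite perm1.
have hub_fix i z : i <= N -> x = c i -> ev (chain_letter m_le nondeg) w (hub i z) = hub i z.
  by move=> iN xi; rewrite ev_chain_letter_hub ?w1 ?mulg1 // => e /wx; rewrite xi.
case: y => i z; have [ex|/negbTE nex] := boolP (exits small_letter m A d i z).
  elim: (w) => [|e w' IHw]; first by rewrite ev_nil perm1.
  by rewrite ev_cons permM permE /step ex IHw.
have yE : (i, z) = hub i z by rewrite hub_stays // inord_val.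
have iN : i <= N by rewrite -ltnS.
have [xi|xi] := eqVneq x (c i); first by rewrite yE hub_fix.
(* A point represented in hub [i] may also lie in the preceding hub, and that one may have colour
   [x]. *)
have [/and4P[i_gt0 im zF /eqP xi1]|noentry] :=
    boolP [&& 0 < i, i < m, z \in face i.-1 & x == c i.-1].
  have <- : hub i.-1 (d i.-1 * z) = (i, z) by rewrite hub_back ?prednK.
  by rewrite hub_fix // (leq_trans (leq_pred i)).
have entry : 0 < i -> i < m -> z \in face i.-1 -> x != c i.-1.
  by move=> i_gt0 im zF; apply: contraNneq noentry => <-; rewrite i_gt0 im zF eqxx.
have closed j u e : j <= N -> u \in strand x i z j -> e \in EQ x -> e \in A j ->
    u * small_letter e \in strand x i z j by move=> _; apply: strand_closed.
have matching j u : j.+1 < m -> u \in face j ->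
    (d j * u \in strand x i z j) = (u \in strand x i z j.+1).
  exact: strand_match.
apply: (@small_universal E o M _ _
  (thread small_letter N m A d (strand x i z)) (EQ x)) w1 _ _ => //.
- by apply: leq_trans leM; apply: card_thread => j; apply: card_strand.
- exact: thread_stable.
- by move=> e y _ _; rewrite chain_letter_order ?perm1 // small_letter_order.
rewrite yE thread_hub // /strand leqnn subnn up0 mem_lcoset mulVg; exact: group1.
Qed.

End Domination.

(** * Acyclic groups *)

Section CoverGroup.
Variables (Q E : finType) (EQ : Q -> {set E}).
Hypothesis EQ_line : forall c c' e e', c != c' -> e \in EQ c -> e \in EQ c' ->
  e' \in EQ c -> e' \in EQ c' -> e' = e.
Hypothesis EQ_simple : forall x c c', x != c -> x != c' -> c != c' ->
  EQ x :&: EQ c :&: EQ c' = set0.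
Variables (o' N K M : nat).
Notation o := o'.+1.
Hypothesis leNM : (N.+1 * o ^ N.+1 <= M.+1)%N.
Hypothesis leKM : (K.+1 * o <= M.+1)%N.
Variables (T : finType) (s : E -> {perm T}).
Hypothesis s_order : forall e, s e ^+ o = 1.
Hypothesis leTM : #|T| <= M.+1.

Notation small_group := {perm small_action E M}.
Notation small_letter := (@small_letter E o M).

(** Colours, elements and length of a chain. The group acts on all chains at once because it is
    fixed before any cycle is given. *)
Definition chain_data : finType :=
  ({ffun 'I_N.+1 -> Q} * {ffun 'I_N.+1 -> small_group} * 'I_N.+2)%type.
Definition dlen (D : chain_data) : nat := D.2.
Definition dset (D : chain_data) i := EQ (D.1.1 (inord i)).
Definition delt (D : chain_data) i := D.1.2 (inord i).
(* The degenerate data are given the trivial action. *)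
Definition proper (D : chain_data) := [forall i : 'I_N.+1, (i.+1 < dlen D) ==>
  (D.1.1 i != D.1.1 (inord i.+1)) && ((0 < i) ==>
  (delt D i \notin glue small_letter (dset D) i.-1 * glue small_letter (dset D) i))].

Lemma dlen_le D : dlen D <= N.+1. Proof. by rewrite -ltnS /dlen ltn_ord. Qed.

Lemma proper_dist D i : proper D -> i.+1 < dlen D ->
  D.1.1 (inord i) != D.1.1 (inord i.+1).
Proof.
move=> /forallP/(_ (inord i)) pD iD; have iN := leq_trans iD (dlen_le D).
by rewrite inordK ?iD ?(ltnW iN) // in pD; case/andP: pD.
Qed.

Lemma proper_nondeg D : proper D -> forall i, 0 < i -> i.+1 < dlen D ->
  delt D i \notin glue small_letter (dset D) i.-1 * glue small_letter (dset D) i.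
Proof.
move=> /forallP pD i i0 iD; have iN := leq_trans iD (dlen_le D).
by have := pD (inord i); rewrite inordK ?iD ?i0 ?(ltnW iN) // => /andP[].
Qed.

Definition chains_step e (x : chain_data * ('I_N.+1 * small_group)) :=
  (x.1, if proper x.1
    then step small_letter (dlen x.1) (dset x.1) (delt x.1) e (small_letter e) x.2
    else x.2).

Lemma chains_step_inj e : injective (chains_step e).
Proof.
move=> [D y] [D' y'] [/= <-]; case: ifP => [pD|_ ->] //.
by move/(can_inj (stepK (dlen_le D) (proper_nondeg pD) e))->.
Qed.

Definition chains_letter e := perm (@chains_step_inj e).

Lemma ev_chains_letter w D y (pD : proper D) :
  ev chains_letter w (D, y) = (D, ev (chain_letter (dlen_le D) (proper_nondeg pD)) w y).
Proof.
elim: w y => [|e w IHw] y; first by rewrite !ev_nil !perm1.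
by rewrite !ev_cons !permM !permE /chains_step /= pD IHw.
Qed.

Lemma ev_chains_letter_bad w D y : ~~ proper D -> ev chains_letter w (D, y) = (D, y).
Proof.
move=> /negbTE pD; elim: w => [|e w IHw]; first by rewrite !ev_nil !perm1.
by rewrite !ev_cons !permM permE /chains_step /= pD IHw.
Qed.

Definition cover_group : finGroupType :=
  (small_group * {perm chain_data * ('I_N.+1 * small_group)} * {perm T})%type.
Definition cover_letter e : cover_group := (small_letter e, chains_letter e, s e).

Lemma ev_cover_letter w : ev cover_letter w = (ev small_letter w, ev chains_letter w, ev s w).
Proof. by elim: w => [|e w IHw]; rewrite ?ev_nil // !ev_cons IHw. Qed.

(** A relation between letters at [x] passes from [small_group] to the chains by [chain_dominated],
    and to [T] because [T] is small. *)
Lemma cover_inj1 x u : u \in gen cover_letter (EQ x) -> u.1.1 = 1 -> u = 1.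
Proof.
case/genP=> w wx ->; rewrite ev_cover_letter /= => w1; congr (_, _, _) => //.
  apply/permP=> -[D y]; rewrite perm1.
  have [pD|pD] := boolP (proper D); last by rewrite ev_chains_letter_bad.
  rewrite ev_chains_letter (@chain_dominated Q E EQ EQ_line EQ_simple o' N M leNM
    (fun i => D.1.1 (inord i)) (delt D) _ _ _ (proper_nondeg pD) x) ?perm1 //.
  by move=> i; apply: proper_dist.
apply/permP=> y; rewrite perm1.
apply: (@small_universal E o M _ s setT setT _ _ _ _ _ w1) => //.
  by rewrite cardsT.
by move=> e y' _ _; rewrite s_order perm1.
Qed.

Lemma cover_inj x u v : u \in gen cover_letter (EQ x) ->
  v \in gen cover_letter (EQ x) -> u.1.1 = v.1.1 -> u = v.
Proof.
move=> ux vx uv; apply/eqP; rewrite eq_mulVg1; apply/eqP/(@cover_inj1 x).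
  by rewrite groupM ?groupV.
by rewrite /= -uv mulVg.
Qed.

Lemma gen_small_lift (B : {set E}) a : a \in gen small_letter B ->
  exists2 u, u \in gen cover_letter B & u.1.1 = a.
Proof.
case/genP=> w wB ->; exists (ev cover_letter w); last by rewrite ev_cover_letter.
by apply/genP; exists w.
Qed.

Lemma gen_cover_proj (B : {set E}) (u : cover_group) :
  u \in gen cover_letter B -> u.1.1 \in gen small_letter B.
Proof. by case/genP=> w wB ->; rewrite ev_cover_letter; apply/genP; exists w. Qed.

(** The intersection property holds in [small_group] and lifts, the projection being injective on
    the subgroup of one colour. *)
Lemma gen_cover_cap c c' :
  gen cover_letter (EQ c) :&: gen cover_letter (EQ c') \subset
  gen cover_letter (EQ c :&: EQ c').
Proof.
apply/subsetP=> u /setIP[uc uc'].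
have /gen_small_lift[v vcc uv] : u.1.1 \in gen small_letter (EQ c :&: EQ c').
  by apply: (subsetP (gen_small_cap _ _ _ _)); rewrite inE !gen_cover_proj.
suff -> : u = v by [].
by apply: (@cover_inj c); rewrite // (subsetP (gen_sub _ (subsetIl _ (EQ c')))).
Qed.

Lemma cover_free_product (L : seq (E * cover_group)) :
  0 < size L -> size L <= K.+1 ->
  {in L, forall p, [/\ exists x, p.1 \in EQ x, p.2 \in <[cover_letter p.1]> & p.2 != 1]} ->
  sorted (fun p q => p.1 != q.1) L -> \prod_(p <- L) p.2 != 1.
Proof.
move=> L0 LK LP srtL; have := @small_free_product E o' K M leKM [seq (p.1, p.2.1.1) | p <- L].
rewrite !size_map sorted_map => /(_ L0 LK) => fp.
have prE : (\prod_(p <- L) p.2 : cover_group).1.1 = \prod_(p <- L) p.2.1.1.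
  by elim: (L) => [|p L' IH]; rewrite ?big_nil // !big_cons -IH.
apply: (contraTneq _ (fp _ _)) => [L1||] //.
  by rewrite big_map -prE L1 eqxx.
move=> _ /mapP[p pL ->] /=; have [[x ex] /cycleP[k pk] pN1] := LP p pL.
have prX n : (cover_letter p.1 ^+ n).1.1 = small_letter p.1 ^+ n
  by rewrite -!ev_nseq ev_cover_letter.
rewrite pk prX mem_cycle /=; apply: contraNneq pN1 => p1.
by rewrite pk; apply/eqP/(@cover_inj1 x); rewrite ?prX // groupX // gen_letter.
Qed.

(* Otherwise the chain of hubs along the cycle is proper, and the product moves
   the point 1 of its first hub to its last hub. *)
Lemma cover_coset_cycle m (c : nat -> Q) (g : nat -> cover_group) : 2 < m -> m <= N.+1 ->
  (forall i, i < m -> g i \in gen cover_letter (EQ (c i))) ->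
  (forall i, i.+1 < m -> c i != c i.+1) ->
  \prod_(i <- iota 0 m) g i = 1 ->
  exists i, [/\ 0 < i, i.+1 < m & g i \in gen cover_letter (EQ (c i.-1) :&: EQ (c i)) *
                                    gen cover_letter (EQ (c i) :&: EQ (c i.+1))].
Proof.
move=> m3 mN gP c_dist g1.
pose deg i := [&& 0 < i, i.+1 < m & g i \in gen cover_letter (EQ (c i.-1) :&: EQ (c i)) *
                                    gen cover_letter (EQ (c i) :&: EQ (c i.+1))].
have [/existsP[i /and3P]|/existsPn nodeg] := boolP [exists i : 'I_m, deg i].
  by exists i.
have m1 : m.-1.+1 = m by rewrite prednK // (leq_trans _ m3).
pose D : chain_data := ([ffun i : 'I_N.+1 => c i], [ffun i : 'I_N.+1 => (g i).1.1], inord m).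
have Dm : dlen D = m by rewrite /dlen inordK.
have DA i : i < m -> dset D i = EQ (c i).
  by move=> im; rewrite /dset ffunE inordK // (leq_trans im).
have Dd i : i < m -> delt D i = (g i).1.1.
  by move=> im; rewrite /delt ffunE inordK // (leq_trans im).
(* A degeneracy of the projected chain lifts to one of the cycle, as the projection is injective on
   the subgroup at [c i]. *)
have pD : proper D.
  apply/forallP=> i; rewrite Dm; apply/implyP=> im.
  rewrite !ffunE inordK ?(leq_trans im) // c_dist //=; apply/implyP=> i0.
  have im1 := ltnW im; have im2 : i.-1 < m by rewrite (leq_ltn_trans (leq_pred i)).
  rewrite Dd // /glue prednK // !DA //.
  apply: contra (nodeg (Ordinal im1)) => /mulsgP[u v] /gen_small_lift[u' u'B <-].
  case/gen_small_lift=> v' v'B <- guv; rewrite /deg i0 im /=.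
  have -> : g i = u' * v'; last exact: mem_mulg.
  apply: (@cover_inj (c i)) => //; first exact: gP.
  apply: groupM; first by apply: (subsetP _ _ u'B); apply/gen_sub/subsetIr.
  by apply: (subsetP _ _ v'B); apply/gen_sub/subsetIl.
have [ws wsP] : exists ws : nat -> seq E, forall i, i < m ->
    {subset ws i <= EQ (c i)} /\ g i = ev cover_letter (ws i).
  have : forall i : 'I_m, exists w : seq E,
      [forall e, (e \in w) ==> (e \in EQ (c i))] && (g i == ev cover_letter w).
    move=> i; have /genP[w wc ->] := gP i (ltn_ord i); exists w.
    by rewrite eqxx andbT; apply/forallP=> e; apply/implyP/wc.
  case/fin_all_exists=> w wP; exists (fun i => if insub i is Some j then w j else [::]).
  move=> i im; rewrite insubT /=; have /andP[/forallP wi /eqP] := wP (Ordinal im).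
  by split=> // e; apply/implyP/wi.
have ev1 : ev cover_letter (flatten [seq ws i | i <- iota 0 m]) = 1.
  rewrite -g1 /ev big_flatten big_map; apply: eq_big_seq => i.
  by rewrite mem_iota => /wsP[_ ->].
have km : m.-1 < dlen D by rewrite Dm m1.
have wsA i : i < dlen D -> {subset ws i <= dset D i}.
  by rewrite Dm => im; rewrite DA //; case: (wsP i im).
have wsd i : i < dlen D -> ev small_letter (ws i) = delt D i.
  by rewrite Dm => im; rewrite Dd // (wsP i im).2 ev_cover_letter.
have := ev_chain_letter_walk (dlen_le D) (proper_nondeg pD) km wsA wsd; rewrite m1.
have -> y : ev (chain_letter (dlen_le D) (proper_nondeg pD))
    (flatten [seq ws i | i <- iota 0 m]) y = y.
  have := ev_chains_letter (flatten [seq ws i | i <- iota 0 m]) y pD.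
  by have := ev1; rewrite ev_cover_letter => -[_ -> _]; rewrite perm1 => /(congr1 snd) /= <-.
have m1N : m.-1 <= N by rewrite -ltnS m1.
case/(hub_eq (dlen_le D) (leq0n N) m1N) => [[m0 _]|[m0 _ _ _]|[]] //.
  by rewrite -m1 -m0 in m3.
by rewrite -m1 -m0 in m3.
Qed.

End CoverGroup.

(** The hypotheses let letters behave like edges of a simple graph on the colours: two colours share
    at most one letter, and no letter lies at three colours. The map [pi] is the projection to the
    last factor. *)
Theorem acyclic_group (Q E : finType) (EQ : Q -> {set E}) (T : finType) (s : E -> {perm T})
    (N K : nat) :
  (forall c c' e e', c != c' -> e \in EQ c -> e \in EQ c' ->
     e' \in EQ c -> e' \in EQ c' -> e' = e) ->
  (forall x c c', x != c -> x != c' -> c != c' -> EQ x :&: EQ c :&: EQ c' = set0) ->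
  exists (gT : finGroupType) (t : E -> gT) (pi : gT -> {perm T}),
  [/\ {morph pi : x y / x * y} /\ forall e, pi (t e) = s e,
      forall c c', gen t (EQ c) :&: gen t (EQ c') \subset gen t (EQ c :&: EQ c'),
      forall L : seq (E * gT), 0 < size L -> size L <= K.+1 ->
        {in L, forall p, [/\ exists x, p.1 \in EQ x, p.2 \in <[t p.1]> & p.2 != 1]} ->
        sorted (fun p q => p.1 != q.1) L -> \prod_(p <- L) p.2 != 1 &
      forall m (c : nat -> Q) (g : nat -> gT), 2 < m -> m <= N.+1 ->
        (forall i, i < m -> g i \in gen t (EQ (c i))) ->
        (forall i, i.+1 < m -> c i != c i.+1) ->
        \prod_(i <- iota 0 m) g i = 1 ->
        exists i, [/\ 0 < i, i.+1 < m & g i \in gen t (EQ (c i.-1) :&: EQ (c i)) *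
                                          gen t (EQ (c i) :&: EQ (c i.+1))]].
Proof.
(* The exponent is the order of the symmetric group on [T], so it kills every [s e]. *)
move=> EQl EQs; pose o' := #|[set: {perm T}]|.-1.
have s_order e : s e ^+ o'.+1 = 1.
  by rewrite /o' prednK ?cardG_gt0 // expg_cardG // inE.
pose M := (N.+1 * o'.+1 ^ N.+1 + K.+1 * o'.+1 + #|T|)%N.
have leNM : (N.+1 * o'.+1 ^ N.+1 <= M.+1)%N by rewrite /M leqW // -addnA leq_addr.
have leKM : (K.+1 * o'.+1 <= M.+1)%N by rewrite /M leqW // -addnA addnCA leq_addr.
have leTM : #|T| <= M.+1 by rewrite /M leqW // leq_addl.
exists (cover_group Q E N M T), (cover_letter EQ o' N M s), snd; split; first by [].
- exact: gen_cover_cap.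
- exact: cover_free_product.
- exact: cover_coset_cycle.
Qed.

(** * Connected sets of cosets *)

Lemma connected_of_not_cut (G : sgraph) (S : {set G}) (x y : G) :
  ~ vertex_cut S -> x \notin S -> y \notin S ->
  exists p, [/\ path (@adj G) x p, last x p = y, uniq (x :: p) &
                {in x :: p, forall z, z \notin S}].
Proof.
move=> nocut xS yS; pose I := induced (~: S).
have xI : x \in ~: S by rewrite inE. have yI : y \in ~: S by rewrite inE.
pose x' : I := Sub x xI; pose y' : I := Sub y yI.
have symI : connect_sym (@adj I) by apply: sym_connect_sym; apply: adj_sym.
have /connectP[p' path_p' lastp'] : connect (@adj I) x' y'.
  apply/negPn/negP=> nxy; apply: nocut.
  rewrite /vertex_cut /nb_components.
  (* If [x'] and [y'] are not connected, their closure alone contributes two components. *)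
  by rewrite (n_compC (closure (@adj I) (pred2 x' y'))) n_comp_closure2 ?nxy.
case/shortenP: path_p' lastp' => p path_p uniq_p _ lastp.
exists (map val p); split.
- by rewrite -[path _ _ _]/(path _ (val x') _) path_map.
- by rewrite (last_map val p x') -lastp.
- by rewrite -[x]/(val x') -map_cons map_inj_uniq //; apply: val_inj.
- rewrite -[x]/(val x') -map_cons => _ /mapP[z _ ->].
  by have := valP z; rewrite inE.
Qed.

Section CosetGraph.
Variables (Q E : finType) (EQ : Q -> {set E}) (gT : finGroupType) (t : E -> gT) (N K : nat).
Hypothesis EQ_simple : forall x c c', x != c -> x != c' -> c != c' ->
  EQ x :&: EQ c :&: EQ c' = set0.
Hypothesis EQ_line : forall c c' e e', c != c' -> e \in EQ c -> e \in EQ c' ->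
  e' \in EQ c -> e' \in EQ c' -> e' = e.
Hypothesis gen_cap : forall c c', gen t (EQ c) :&: gen t (EQ c') \subset gen t (EQ c :&: EQ c').
Hypothesis free_product_t : forall L : seq (E * gT),
  0 < size L -> size L <= K.+1 ->
  {in L, forall p, [/\ exists x, p.1 \in EQ x, p.2 \in <[t p.1]> & p.2 != 1]} ->
  sorted (fun p q => p.1 != q.1) L -> \prod_(p <- L) p.2 != 1.
Hypothesis coset_cycle_t : forall m (c : nat -> Q) (g : nat -> gT), 2 < m -> m <= N.+1 ->
  (forall i, i < m -> g i \in gen t (EQ (c i))) ->
  (forall i, i.+1 < m -> c i != c i.+1) ->
  \prod_(i <- iota 0 m) g i = 1 ->
  exists i, [/\ 0 < i, i.+1 < m & g i \in gen t (EQ (c i.-1) :&: EQ (c i)) *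
                                    gen t (EQ (c i) :&: EQ (c i.+1))].

Variables (U : sgraph) (col : U -> Q) (rep : U -> gT).
Definition cell s := rep s *: gen t (EQ (col s)).
Hypothesis same_cell : forall s r x, col s = col r -> x \in cell s -> x \in cell r -> s = r.
Hypothesis adj_cell : forall s r, adj s r ->
  [/\ cell s :&: cell r != set0, EQ (col s) :&: EQ (col r) = set0 & col s != col r].
Hypothesis card_U : #|U| <= N.
Hypothesis leNK : N.*2 <= K.+1.

Definition touch s r := cell s :&: cell r != set0.

Lemma cell_div s x y : x \in cell s -> y \in cell s -> x^-1 * y \in gen t (EQ (col s)).
Proof.
rewrite !mem_lcoset => xs ys; have := groupM (groupVr xs) ys.
by rewrite invMg invgK -mulgA mulKVg.
Qed.

Lemma cell_mul s x u : x \in cell s -> u \in gen t (EQ (col s)) -> x * u \in cell s.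
Proof. by rewrite !mem_lcoset mulgA => *; apply: groupM. Qed.

Lemma touch_col s r : s != r -> touch s r -> col s != col r.
Proof.
move=> sr /set0Pn[x /setIP[xs xr]]; apply: contraNneq sr => ec.
by apply/eqP; apply: same_cell ec xs xr.
Qed.

(** The quotients of successive meeting points multiply to 1, and a degenerate quotient gives a
    point common to three consecutive cells. The middle one of these is never [s]. *)
Lemma touching_cycle (s : U) (l : seq U) :
  1 < size l -> size l <= N -> sorted touch (s :: l) -> touch (last s l) s ->
  uniq (s :: l) ->
  exists i x, [/\ i.+1 < size l, x \in cell (nth s (s :: l) i),
                  x \in cell (nth s l i) & x \in cell (nth s l i.+1)].
Proof.
move=> l2 lN srt cl un; set vs := s :: l.
pose v i := nth s vs i.
have vt i : i < size l -> touch (v i) (v i.+1) by move=> il; apply: (sortedP s srt).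
have vcol i : i < size l -> col (v i) != col (v i.+1).
  move=> il; apply: touch_col (vt i il).
  have i1 : i < size vs by rewrite ltnS ltnW.
  by rewrite (nth_uniq s i1 (il : i.+1 < size vs) un) ltn_eqF.
pose X i := if i < size l then cell (v i) :&: cell (v i.+1) else cell (last s l) :&: cell s.
pose p i := odflt 1 [pick x in X i].
have pP i : p i \in X i.
  rewrite /p; case: pickP => //= no.
  suff /set0Pn[x xP] : X i != set0 by have := no x; rewrite xP.
  by rewrite /X; case: ifP => [/vt|_].
have vlast : v (size l) = last s l by rewrite /v /vs -last_nth.
have pl i : i < size l -> p i \in cell (v i) /\ p i \in cell (v i.+1).
  by move=> il; have := pP i; rewrite /X il => /setIP.
have pe : p (size l) \in cell (last s l) /\ p (size l) \in cell s.
  by have := pP (size l); rewrite /X ltnn => /setIP.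
pose g i := (if i is i'.+1 then p i' else p (size l))^-1 * p i.
have l0 : 0 < size l by apply: leq_trans l2.
have [|||||i [i0 il /mulsgP[f f' fF fF' gE]]] :=
    @coset_cycle_t (size l).+1 (fun i => col (v i)) g.
- by [].
- by rewrite ltnS.
- move=> [|i] il; first by apply: cell_div; [exact: pe.2 | exact: (pl 0 l0).1].
  rewrite ltnS in il; apply: cell_div; first exact: (pl i il).2.
  have [il1|] := ltnP i.+1 (size l); first exact: (pl _ il1).1.
  move=> li; have <- : size l = i.+1 by apply/eqP; rewrite eqn_leq li.
  by rewrite vlast; exact: pe.1.
- by move=> i il; apply: vcol.
- have tele k : \prod_(i <- iota 0 k.+1) g i = (p (size l))^-1 * p k.
    elim: k => [|k IHk]; first by rewrite big_seq1.
    have -> : iota 0 k.+2 = iota 0 k.+1 ++ [:: k.+1] by rewrite -[k.+2]addn1 iotaD.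
    by rewrite big_cat big_seq1 IHk /= -mulgA mulKVg.
  by rewrite tele mulVg.
rewrite ltnS in il; case: i i0 il fF fF' gE => // i _ il fF fF' gE.
have il' := ltnW il; exists i, (p i * f); split => //.
- by apply: cell_mul (pl i il').1 _; apply: (subsetP _ _ fF); apply/gen_sub/subsetIl.
- by apply: cell_mul (pl i il').2 _; apply: (subsetP _ _ fF); apply/gen_sub/subsetIr.
have -> : p i * f = p i.+1 * f'^-1 by rewrite -[p i.+1](mulKVg (p i)) -/(g i.+1) gE mulgA mulgK.
apply: cell_mul (pl _ il).2 _; rewrite groupV.
by apply: (subsetP _ _ fF'); apply/gen_sub/subsetIr.
Qed.

Section Chains.
Variable s : U.

(* A walk inside the cell of s from k to h whose steps stay in the cells of
   vertices of R; each entry of L is such a vertex with the end of its step. *)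
Fixpoint chain (R : seq U) (k : gT) (L : seq (U * gT)) (h : gT) : bool :=
  if L is (r, k') :: L' then
    [&& [&& r \in R, k \in cell s, k \in cell r, k' \in cell s & k' \in cell r],
        k != k', (if L' is (r', _) :: _ then r' != r else true) & chain R k' L' h]
  else k == h.

Lemma chain_consE R k r k' L h : chain R k ((r, k') :: L) h =
  [&& [&& r \in R, k \in cell s, k \in cell r, k' \in cell s & k' \in cell r],
      k != k', (if L is (r', _) :: _ then r' != r else true) & chain R k' L h].
Proof. by []. Qed.

Lemma chain_mono R R' k L h : {subset R <= R'} -> chain R k L h -> chain R' k L h.
Proof.
move=> sRR'; elim: L k => //= -[r k'] L IHL k.
by case/and4P=> /and5P[/sRR'-> -> -> -> ->] -> -> /IHL->.
Qed.

(** A trivial step is dropped, and a step in the same cell as the first step of [L] is merged with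
    it. *)
Lemma chain_cons R r k0 k1 L h : r \in R -> k0 \in cell s -> k0 \in cell r ->
  k1 \in cell s -> k1 \in cell r -> chain R k1 L h ->
  exists2 L', chain R k0 L' h & size L' <= (size L).+1.
Proof.
move=> rR k0s k0r k1s k1r ch1; have [<-|k01] := eqVneq k1 k0; first by exists L.
rewrite eq_sym in k01.
case: L ch1 => [|[r' k2] L] ch1.
  by exists [:: (r, k1)]; rewrite //= rR k0s k0r k1s k1r k01 /=.
have [er|nr] := eqVneq r' r; last first.
  exists [:: (r, k1), (r', k2) & L] => //.
  by rewrite chain_consE rR k0s k0r k1s k1r k01 nr /=.
case/and4P: ch1 => /and5P[_ _ _ k2s k2r] _ hd ch2; rewrite er in k2r hd.
have [k02|k02] := eqVneq k0 k2; first by exists L; rewrite ?k02 // 2?ltnW.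
by exists ((r, k2) :: L); rewrite //= rR k0s k0r k2s k2r k02 hd.
Qed.

Lemma chain_cat R1 R2 k1 L1 k2 r k3 L2 h : chain R1 k1 L1 k2 ->
  chain R2 k2 ((r, k3) :: L2) h -> r \notin R1 ->
  chain (R1 ++ R2) k1 (L1 ++ (r, k3) :: L2) h.
Proof.
move=> ch1 ch2 rR1; elim: L1 k1 ch1 => [|[r1 k'] L1 IHL] k1.
  move=> /eqP->; apply: chain_mono ch2 => x xR; by rewrite mem_cat xR orbT.
case/and4P=> /and5P[r1R k1s k1r k's k'r] nk hd /IHL ch.
rewrite cat_cons chain_consE mem_cat r1R k1s k1r k's k'r nk ch /= andbT.
by case: (L1) hd => [|[r2 k2'] L1'] //= _; apply: contraNneq rR1 => ->.
Qed.

(** The path closes up through [s] to a cycle, in which three consecutive cells share a point [x].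
    If they are [s] and the first two cells of the path, the chain steps from [g] to [x] and goes on
    from the second cell. Otherwise the middle cell is removed from the path, its neighbours
    touching at [x]. *)
Lemma path_chain n r R g h : size R <= n -> size R < N -> path touch r R ->
  uniq (r :: R) -> s \notin r :: R -> g \in cell s -> g \in cell r ->
  h \in cell s -> h \in cell (last r R) ->
  exists2 L, chain (r :: R) g L h & size L <= size (r :: R).
Proof.
elim: n r R g => [|n IHn] r R g.
  case: R => // _ _ _ _ _ gs gr hs hr.
  by apply: (@chain_cons _ r g h [::] h); rewrite ?mem_head //= eqxx.
case: R => [|r1 R] szR ltN pR un sR gs gr hs hl.
  by apply: (@chain_cons _ r g h [::] h); rewrite ?mem_head //= eqxx.
have srt : sorted touch [:: s, r, r1 & R].
  by rewrite /= in pR *; rewrite pR andbT; apply/set0Pn; exists g; rewrite inE gs.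
have cl : touch (last s [:: r, r1 & R]) s by apply/set0Pn; exists h; rewrite inE hl.
have [|||i [x [ilt xp xi xn]]] := touching_cycle _ _ srt cl _ => //.
  by rewrite /= in sR un *; rewrite sR.
case: i => [|i] in ilt xp xi xn.
  have [|||||||||L chL szL] := IHn r1 R x; rewrite //= ?(ltnW ltN) //.
  - by case/andP: pR.
  - by case/andP: un.
  - by move: sR; rewrite inE negb_or => /andP[].
  have chL' : chain [:: r, r1 & R] x L h.
    by apply: chain_mono chL => y yR; rewrite inE yR orbT.
  have [L' chL'' szL'] := chain_cons (mem_head _ _) gs gr xp xi chL'.
  by exists L' => //; apply: leq_trans szL' _.
rewrite /= in xp.
have [P [p [q [y [W [lE pE qE yE]]]]]] : exists P p q y W,
    [/\ [:: r, r1 & R] = P ++ [:: p, q, y & W], nth s [:: r, r1 & R] i = p,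
        nth s [:: r, r1 & R] i.+1 = q & nth s [:: r, r1 & R] i.+2 = y].
  set l := [:: r, r1 & R] in ilt *.
  exists (take i l), (nth s l i), (nth s l i.+1), (nth s l i.+2), (drop i.+3 l).
  split=> //; rewrite -(drop_nth s ilt) -(drop_nth s (ltnW ilt)).
  by rewrite -(drop_nth s (ltnW (ltnW ilt))) cat_take_drop.
rewrite pE in xp; rewrite qE in xi; rewrite yE in xn.
have [R' R'E] : exists R', P ++ [:: p, y & W] = r :: R'.
  by case: (P) lE => [[->]|r' P' [->]]; [exists (y :: W) | exists (P' ++ [:: p, y & W])].
have sub : subseq (r :: R') [:: r, r1 & R].
  rewrite -R'E lE cat_subseq //= eqxx; exact: (subseq_cons (y :: W) q).
have szE : (size R').+2 = size [:: r, r1 & R].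
  by rewrite lE -[(size R').+1]/(size (r :: R')) -R'E !size_cat /= !addnS.
have srt' : sorted touch (r :: R').
  have : sorted touch [:: r, r1 & R] by [].
  have py : touch p y by apply/set0Pn; exists x; rewrite inE xp.
  rewrite -R'E lE; case: (P) => [|p0 P'] /=; first by rewrite py => /and3P[].
  by rewrite !cat_path /= py => /and5P[-> -> _ _ ->].
have lastE : last r R' = last r (r1 :: R).
  rewrite -[LHS]/(last r (r :: R')) -R'E -[RHS]/(last r [:: r, r1 & R]) lE.
  by rewrite !last_cat.
have [|||||||||L chL szL] := IHn r R' g; rewrite ?lastE //.
- by case: szE => szE; move: szR; rewrite /= -szE.
- by case: szE => szE; move: ltN; rewrite /= -szE; apply: ltnW.
- exact: subseq_uniq sub un.
- by apply: contra sR; apply: mem_subseq.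
exists L; first by apply: chain_mono chL; apply: mem_subseq.
by rewrite (leq_trans szL) // size_subseq.
Qed.

Lemma letter_step r k k' : k \in cell s -> k \in cell r -> k' \in cell s -> k' \in cell r ->
  k != k' -> s != r ->
  exists e, [/\ e \in EQ (col s), e \in EQ (col r) & k^-1 * k' \in <[t e]>].
Proof.
move=> ks kr k's k'r kk' sr.
have csr : col s != col r by apply: touch_col => //; apply/set0Pn; exists k; rewrite inE ks.
have : k^-1 * k' \in gen t (EQ (col s) :&: EQ (col r)).
  by apply: (subsetP (gen_cap _ _)); rewrite inE !cell_div.
have [->|[e]] := set_0Vmem (EQ (col s) :&: EQ (col r)).
  by rewrite gen_empty inE -eq_mulVg1 (negbTE kk').
rewrite inE => /andP[es er] kk; exists e; split=> //.
apply: (subsetP _ _ kk); apply: gen_sub_cycle => e'; rewrite inE => /andP[es' er'].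
exact: EQ_line csr es er es' er'.
Qed.

(** The cells share [k], so their colours are distinct, and no letter lies at three colours. *)
Lemma letter_distinct r r' k e e' : s != r -> s != r' -> r != r' ->
  k \in cell s -> k \in cell r -> k \in cell r' ->
  e \in EQ (col s) -> e \in EQ (col r) -> e' \in EQ (col r') -> e != e'.
Proof.
move=> sr sr' rr' ks kr kr' es er er'; apply: contraTneq isT => ee'; subst e'.
have tc u v : u != v -> k \in cell u -> k \in cell v -> col u != col v.
  by move=> uv ku kv; apply: touch_col => //; apply/set0Pn; exists k; rewrite inE ku.
have := EQ_simple (tc _ _ sr ks kr) (tc _ _ sr' ks kr') (tc _ _ rr' kr kr').
by move/setP/(_ e); rewrite !inE es er er'.
Qed.

(** Every step is a power of the one letter shared by two colours. The last clause records the first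
    letter, to compare it with that of a preceding step. *)
Lemma chain_word R k L h : s \notin R -> chain R k L h ->
  exists W : seq (E * gT), [/\ size W = size L,
    {in W, forall p, [/\ exists x, p.1 \in EQ x, p.2 \in <[t p.1]> & p.2 != 1]},
    sorted (fun p q => p.1 != q.1) W, \prod_(p <- W) p.2 = k^-1 * h &
    (if L is (r, _) :: _ then if W is (e, _) :: _
       then (e \in EQ (col s)) && (e \in EQ (col r)) else true else true)].
Proof.
move=> sR; elim: L k => [|[r k'] L IHL] k.
  by move=> /eqP->; exists [::]; split; rewrite // big_nil mulVg.
rewrite chain_consE => /and4P[/and5P[rR ks kr k's k'r] kk' hd ch].
have sr r0 : r0 \in R -> s != r0 by move=> r0R; apply: contraNneq sR => ->.
have [W [szW WP srtW prW hdW]] := IHL k' ch.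
have [e [es er ek]] := letter_step ks kr k's k'r kk' (sr r rR).
exists ((e, k^-1 * k') :: W); split=> /=; last by rewrite es er.
- by rewrite szW.
- move=> p; rewrite inE => /orP[/eqP->|/WP//]; split=> //; first by exists (col s).
  by rewrite /= -eq_mulVg1.
- case: W szW WP srtW prW hdW => //= -[e' f'] W szW _ -> _.
  case: L hd ch szW {IHL} => //= -[r' k2] L r'r /and4P[/and5P[r'R _ k'r' _ _] _ _ _] _.
  case/andP=> es' er'; rewrite andbT.
  by apply: (letter_distinct (sr r rR) (sr r' r'R) _ k's k'r k'r' es er er'); rewrite eq_sym.
- by rewrite big_cons prW /= -mulgA mulKVg.
Qed.

Lemma no_closed_chain R k L : s \notin R -> 0 < size L -> size L <= K.+1 ->
  ~~ chain R k L k.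
Proof.
move=> sR L0 LK; apply/negP=> /(chain_word sR)[W [szW WP srtW prW _]].
have /negP[] : \prod_(p <- W) p.2 != 1 by apply: free_product_t; rewrite ?szW.
by rewrite prW mulVg.
Qed.

End Chains.

Hypothesis conU : connected U.
Hypothesis no_cut : ~ has_cut_vertex U.
Hypothesis no_two_cut : ~ has_nonadjacent_two_cut U.

Lemma adj_meet_uniq s r x y : adj s r -> x \in cell s -> x \in cell r ->
  y \in cell s -> y \in cell r -> x = y.
Proof.
move=> asr xs xr ys yr; have [_ EQ0 _] := adj_cell asr.
have : x^-1 * y \in gen t (EQ (col s) :&: EQ (col r)).
  by apply: (subsetP (gen_cap _ _)); rewrite inE !cell_div.
by rewrite EQ0 gen_empty inE -eq_mulVg1 => /eqP.
Qed.

(* Otherwise two different routes from a to b in the cell of s, read off from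
   paths in U - s and U - {s, r'}, contradict freeness; r' is the first vertex
   on the first route. *)
Lemma single_meet s r u a b : adj s r -> adj s u ->
  a \in cell s -> a \in cell r -> b \in cell s -> b \in cell u -> a = b.
Proof.
move=> asr asu as_ ar bs bu; apply/eqP/negPn/negP=> ab.
have adj_neq v w : adj v w -> v != w :> U.
  by apply: contraTneq => ->; rewrite adj_irrefl.
have adj_path_touch v p : path (@adj U) v p -> path touch v p.
  by apply: sub_path => v' w' /adj_cell[].
have size_path (v : U) p : uniq (v :: p) -> s \notin v :: p -> (size p).+2 <= N.
  move=> un sp; apply: leq_trans card_U; rewrite -[(size p).+2]/(size [:: s, v & p]).
  by rewrite -(card_uniqP _) ?max_card //= sp.
have ne1 v : adj s v -> v \notin [set s] by move/adj_neq; rewrite inE eq_sym.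
have not_cut1 : ~ vertex_cut [set s] by move=> cut; apply: no_cut; exists s.
have [p [path_p last_p un_p sp]] := connected_of_not_cut not_cut1 (ne1 r asr) (ne1 u asu).
have s_notin (S : {set U}) (q : seq U) : s \in S -> {in q, forall z, z \notin S} -> s \notin q.
  by move=> sS qS; apply/negP=> /qS; rewrite sS.
have sp' := s_notin _ _ (set11 s) sp.
have szp := size_path _ _ un_p sp'.
have [|L chL szL] := path_chain (leqnn _) (ltnW szp) (adj_path_touch _ _ path_p) un_p sp' as_ ar bs.
  by rewrite last_p.
case: L chL szL => [/eqP eab|[r' k'] L chL szL]; first by rewrite eab eqxx in ab.
have /and4P[/and5P[r'p _ ar' k's k'r'] ak' _ _] := chL.
have sr' : s != r' by apply: contraNneq sp' => ->.
(* The first step moves [a] within the cells of both [s] and [r'], while adjacent cells meet in one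
   point. *)
have nsr' : ~~ adj s r'.
  by apply: contraNN ak' => asr'; apply/eqP; apply: adj_meet_uniq asr' _ _ _ _.
have ne2 v : adj s v -> v \notin [set s; r'].
  move=> asv; have := ne1 v asv; rewrite !inE => vs; rewrite negb_or vs.
  by apply: contraNneq nsr' => <-.
have not_cut2 : ~ vertex_cut [set s; r'].
  by move=> cut; apply: no_two_cut; exists s, r'.
have [q [path_q last_q un_q sq]] := connected_of_not_cut not_cut2 (ne2 u asu) (ne2 r asr).
have sq' := s_notin _ _ (set21 s r') sq.
have szq := size_path _ _ un_q sq'.
have [|L' chL' szL'] :=
  path_chain (leqnn _) (ltnW szq) (adj_path_touch _ _ path_q) un_q sq' bs bu as_.
  by rewrite last_q.
(* The second route avoids [r'], so it can be followed by the first one without two equal cells at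
   the seam. *)
have r'q : r' \notin u :: q by apply/negP=> /sq; rewrite !inE eqxx orbT.
have := chain_cat chL' chL r'q; apply/negP/no_closed_chain.
- by rewrite mem_cat negb_or sq' sp'.
- by rewrite size_cat addnS.
rewrite size_cat (leq_trans (leq_add szL' szL)) // (leq_trans _ leNK) // -addnn leq_add //.
  exact: ltnW.
exact: ltnW.
Qed.

(** All edges at one vertex have the same meeting point by [single_meet]; connectedness carries it
    along paths. *)
Lemma common_meet : exists g, forall s r x, adj s r -> x \in cell s -> x \in cell r -> x = g.
Proof.
pose P := [pred sr : U * U | adj sr.1 sr.2].
have [[s0 r0] /= asr0|no] := pickP P; last first.
  by exists 1 => s r x asr; have := no (s, r); rewrite /= asr.
have meet s r : adj s r -> exists2 x, x \in cell s & x \in cell r.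
  by case/adj_cell=> /set0Pn[x /setIP[]]; exists x.
have [g gs0 gr0] := meet s0 r0 asr0; exists g => s r x asr xs xr.
have /connectP[p path_p sE] := conU.2 s0 s.
suff walk : forall q v w x, path (@adj U) v q ->
    (forall w' x', adj v w' -> x' \in cell v -> x' \in cell w' -> x' = g) ->
    adj (last v q) w -> x \in cell (last v q) -> x \in cell w -> x = g.
  rewrite sE in asr xs; apply: walk path_p _ asr xs xr => w x' aw xw xw'.
  exact: single_meet aw asr0 xw xw' gs0 gr0.
move=> {asr xs xr}; elim=> [|v' q IHq] v w y /=; first by move=> _ vg /vg; apply.
case/andP=> avv' path_q vg; apply: IHq path_q _ => w' x' av'w' xv' xw'.
have [z zv zv'] := meet _ _ avv'.
rewrite (single_meet av'w' _ xv' xw' zv' zv) 1?adj_sym //; exact: vg avv' zv zv'.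
Qed.

End CosetGraph.

(** * Saturation *)

Definition embeds (F G : sgraph) := [exists f : {ffun F -> G},
  injectiveb f && [forall x, forall y, adj (f x) (f y) == adj x y]].

Lemma embedsP (F G : sgraph) : reflect
  (exists2 f : F -> G, injective f & forall x y, adj (f x) (f y) = adj x y) (embeds F G).
Proof.
apply: (iffP existsP) => [[f /andP[/injectiveP f_inj /forallP fP]]|[f f_inj fP]].
  by exists f => // x y; have /forallP/(_ y)/eqP := fP x.
exists [ffun x => f x]; apply/andP; split.
  by apply/injectiveP=> x y; rewrite !ffunE; apply: f_inj.
by apply/forallP=> x; apply/forallP=> y; rewrite !ffunE fP.
Qed.

Lemma embeds_trans (F G I : sgraph) : embeds F G -> embeds G I -> embeds F I.
Proof.
move=> /embedsP[f f_inj fP] /embedsP[g g_inj gP]; apply/embedsP.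
by exists (g \o f) => [|x y /=]; [exact: inj_comp | rewrite gP].
Qed.

Lemma contains_inducedP (F G : sgraph) : contains_induced F G <-> embeds F G.
Proof.
split=> [[S [f f_bij fP]]|/embedsP[f f_inj fP]].
  apply/embedsP; exists (fun x => val (f x)); last exact: fP.
  exact: inj_comp val_inj (bij_inj f_bij).
have fS x : f x \in [set f y | y in F] by apply: imset_f.
pose h x : induced [set f y | y in F] := Sub (f x) (fS x).
exists [set f y | y in F], h => [|x y]; last exact: fP.
apply: inj_card_bij => [x y /(congr1 val) /f_inj //|].
rewrite card_sig; apply: leq_trans (leq_imset_card f F).
by apply/subset_leq_card/subsetP=> x; rewrite inE.
Qed.

(** The last hypothesis concerns every graph that contains [G] and avoids [kept], because the graph
    grows during the induction on its nonedges. A nonedge whose addition creates no [H] is thus not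
    kept, and the kept pair that exists prevents completeness. *)
Lemma saturation (H G : sgraph) (kept : rel G) :
  symmetric kept -> (exists u v, u != v /\ kept u v) ->
  (forall u v, kept u v -> ~~ adj u v) -> ~~ embeds H G ->
  (forall (e : rel G) (e_sym : symmetric e) (e_irr : irreflexive e),
     (forall u v, adj u v -> e u v) -> (forall u v, kept u v -> ~~ e u v) ->
     forall u v : SGraph e_sym e_irr, u != v -> kept u v -> embeds H (add_edge u v)) ->
  exists J, addition_host H J.
Proof.
move=> kept_sym [u0 [v0 [uv0 kuv0]]] keptN HG keptH.
have [n] := ubnP #|[set p : G * G | ~~ adj p.1 p.2]|.
have sGe u v : adj u v -> @adj G u v by [].
have : forall e e_sym e_irr, #|[set p : G * G | ~~ e p.1 p.2]| < n ->
    (forall u v, @adj G u v -> e u v) -> (forall u v, kept u v -> ~~ e u v) ->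
    ~~ embeds H (@SGraph G e e_sym e_irr) -> exists J, addition_host H J.
  elim: n => // n IHn e e_sym e_irr en Ge eN He.
  pose J := @SGraph G e e_sym e_irr.
  pose bad (p : G * G) := [&& p.1 != p.2, ~~ e p.1 p.2 & ~~ embeds H (@add_edge J p.1 p.2)].
  have [[u v] /and3P[/= uv euv Huv]|good] := pickP bad; last first.
    exists J; split.
    - by move=> /(_ u0 v0 uv0); apply/negP/eN.
    - by move/contains_inducedP; apply/negP.
    - move=> u v uv euv; apply/contains_inducedP; apply: contraT => Huv.
      by have := good (u, v); rewrite /bad /= uv (euv : ~~ e u v) Huv.
  apply: (IHn _ (@add_edge_sym J u v) (@add_edge_irrefl J u v)) => //.
  - have : [set p : G * G | ~~ @add_edge_adj J u v p.1 p.2] \proper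
           [set p : G * G | ~~ e p.1 p.2].
      apply/properP; split.
        by apply/subsetP=> p; rewrite !inE negb_or => /andP[].
      by exists (u, v); rewrite !inE //= /add_edge_adj /= uv eqxx orbT.
    by move/proper_card => lt; apply: leq_trans lt _; rewrite -ltnS.
  - by move=> x y /Ge exy; apply/orP; left.
  move=> x y kxy; rewrite /add_edge_adj /= negb_or eN //=; apply/negP=> /andP[xy /eqP exy].
  have kuv : kept u v.
    have : x \in [set u; v] by rewrite -exy set21.
    have : y \in [set u; v] by rewrite -exy set22.
    rewrite !inE => /orP[]/eqP yE /orP[]/eqP xE; subst x y; rewrite ?eqxx // in xy kxy *.
    by rewrite kept_sym.
  by move/negP: Huv; apply; apply: keptH.
move=> step lt; apply: (step _ (@adj_sym G) (@adj_irrefl G)) lt sGe keptN _.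
(* Destructing [G] identifies it with the graph rebuilt from its fields. *)
by case: (G) HG.
Qed.

(** * The host *)

Section Colours.
Variables (H : sgraph) (a b : H).
Hypothesis ab : adj a b.
Notation F := (del_edge a b).

Definition colour : finType := (H * {ffun H -> bool})%type.
(* The bit recorded by c about d.1 and the one recorded by d about c.1 decide
   together whether c and d are adjacent; hence partial copies of F extend. *)
Definition radj : rel colour := fun c d => (c.1 != d.1) && (c.2 d.1 != d.2 c.1).

Lemma radj_sym : symmetric radj.
Proof. by move=> c d; rewrite /radj eq_sym [c.2 _ == _]eq_sym. Qed.

Definition open_pair (e : {set colour}) :=
  [exists c, exists d, [&& c.1 != d.1, ~~ radj c d & e == [set c; d]]].
(** Any set of colours is a letter, but only open pairs lie at a colour. *)
Definition star (c : colour) : {set {set colour}} := [set e | open_pair e && (c \in e)].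

Lemma star_pair c d e : c != d -> e \in star c -> e \in star d ->
  [/\ e = [set c; d], c.1 != d.1 & ~~ radj c d].
Proof.
rewrite !inE => cd /andP[/existsP[c' /existsP[d' /and3P[cd' ncd /eqP->]]] ce] /andP[_ de].
move: ce de; rewrite !inE => /orP[]/eqP ec /orP[]/eqP ed; subst c d; rewrite ?eqxx // in cd *.
by split; [rewrite setUC | rewrite eq_sym | rewrite radj_sym].
Qed.

Lemma star_line c c' e e' : c != c' -> e \in star c -> e \in star c' ->
  e' \in star c -> e' \in star c' -> e' = e.
Proof.
move=> cc' ec ec' e'c e'c'.
by have [-> _ _] := star_pair cc' ec ec'; have [-> _ _] := star_pair cc' e'c e'c'.
Qed.

Lemma star_simple x c c' : x != c -> x != c' -> c != c' ->
  star x :&: star c :&: star c' = set0.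
Proof.
move=> xc xc' cc'; apply/setP=> e; rewrite [LHS]inE [in LHS]inE [RHS]inE.
apply/negbTE/negP=> /andP[/andP[ex ec]]; have [-> _ _] := star_pair xc ex ec.
by rewrite !inE eq_sym (negbTE xc') eq_sym (negbTE cc') andbF.
Qed.

Lemma star_radj c d : radj c d -> star c :&: star d = set0.
Proof.
move=> rcd; apply/setP=> e; rewrite [RHS]inE; apply/negbTE/setIP=> -[ec ed].
have cd : c != d by apply: contraTneq rcd => ->; rewrite /radj eqxx.
by have [_ _ /negP] := star_pair cd ec ed.
Qed.

Definition state : finType := {ffun H -> colour}.
Definition valid (s : state) := [forall x, forall y, (x != y) ==>
  ((s x).1 != (s y).1) && (radj (s x) (s y) == @adj F x y)].

Lemma validP (s : state) : reflect
  (forall x y, x != y -> (s x).1 != (s y).1 /\ radj (s x) (s y) = @adj F x y) (valid s).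
Proof.
apply: (iffP forallP) => [sP x y xy|sP x].
  by have /forallP/(_ y) := sP x; rewrite xy => /andP[-> /eqP].
by apply/forallP=> y; apply/implyP=> /sP[-> ->]; rewrite eqxx.
Qed.

Lemma valid_inj (s : state) : valid s -> injective s.
Proof.
by move=> /validP sP x y sxy; apply: contraTeq isT => /sP[]; rewrite sxy eqxx.
Qed.

(** The colours of [a] and [b] are prescribed; every other pair of vertices still has a free bit,
    which is set to produce the adjacency of [F]. *)
Lemma extend_state (c d : colour) : c.1 != d.1 -> ~~ radj c d ->
  exists s, [/\ valid s, s a = c & s b = d].
Proof.
move=> cd ncd; have nab : a != b by apply: contraTneq ab => ->; rewrite adj_irrefl.
have [pi pia pib] : exists2 pi : {perm H}, pi a = c.1 & pi b = d.1.
  pose p1 := tperm a c.1; exists (p1 * tperm (p1 b) d.1); last by rewrite permM tpermL.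
  rewrite permM tpermL tpermD // 1?eq_sym //.
  by rewrite -[X in X != _](tpermL a c.1) (inj_eq perm_inj).
have ba : (b == a) = false by rewrite eq_sym; apply: negbTE.
have Fab : @adj F a b = false by rewrite /= /del_edge_adj eqxx andbF.
(* Against [a] or [b] the bit of [u] corrects the prescribed one. Between two other vertices only
   the one of smaller rank records the adjacency. *)
pose bits (u : H) : {ffun H -> bool} := [ffun x =>
  let u' := (pi^-1)%g x in
  if u' == a then c.2 (pi u) (+) @adj F u a
  else if u' == b then d.2 (pi u) (+) @adj F u b
  else (enum_rank u < enum_rank u') && @adj F u u'].
pose s : state := [ffun u => if u == a then c else if u == b then d else (pi u, bits u)].
have sa : s a = c by rewrite ffunE eqxx.
have sb : s b = d by rewrite ffunE ba eqxx.
have s1 u : (s u).1 = pi u.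
  by rewrite ffunE; case: eqP => [->|_]; [|case: eqP => [->|]].
have sbits u : u != a -> u != b -> s u = (pi u, bits u).
  by move=> ua ub; rewrite ffunE (negbTE ua) (negbTE ub).
exists s; split=> //; apply/validP=> x y xy.
have sxy : (s x).1 != (s y).1 by rewrite !s1 (inj_eq perm_inj).
split=> //; rewrite /radj sxy /= -/(@adj F x y).
have bit_a u : u != a -> u != b -> ((s u).2 (s a).1 != (s a).2 (s u).1) = @adj F u a.
  move=> ua ub; rewrite !s1 sbits // sa /= ffunE permK /= eqxx.
  by case: (c.2 _); case: del_edge_adj.
have bit_b u : u != a -> u != b -> ((s u).2 (s b).1 != (s b).2 (s u).1) = @adj F u b.
  move=> ua ub; rewrite !s1 sbits // sb /= ffunE permK /= ba eqxx.
  by case: (d.2 _); case: del_edge_adj.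
have bit_ab : ((s a).2 (s b).1 != (s b).2 (s a).1) = @adj F a b.
  by rewrite Fab; move: ncd; rewrite /radj -sa -sb !s1 (inj_eq perm_inj) nab /= => /negbTE.
have flip u v : ((s u).2 (s v).1 != (s v).2 (s u).1) = @adj F u v ->
    ((s v).2 (s u).1 != (s u).2 (s v).1) = @adj F v u.
  by move=> uv; rewrite eq_sym uv adj_sym.
have [xa|xa] := eqVneq x a.
  subst x; have [->//|yb] := eqVneq y b.
  by apply/flip/bit_a; rewrite // eq_sym.
have [xb|xb] := eqVneq x b.
  subst x; have [->|ya] := eqVneq y a; first exact: flip.
  by apply/flip/bit_b; rewrite // eq_sym.
have [->|ya] := eqVneq y a; first exact: bit_a.
have [->|yb] := eqVneq y b; first exact: bit_b.
rewrite !s1 !sbits //= !ffunE !permK /= (negbTE xa) (negbTE xb) (negbTE ya) (negbTE yb).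
rewrite -![del_edge_adj _ _ _ _]/(@adj F _ _) [@adj F y x]adj_sym.
have : enum_rank x != enum_rank y by rewrite (inj_eq enum_rank_inj).
by rewrite -(inj_eq val_inj) neq_ltn /=; case: ltngtP => //= _ _; case: del_edge_adj.
Qed.

Definition states_over (e : {set colour}) : seq state :=
  enum [set s : state | valid s && (e \subset codom s)].

Lemma states_over_uniq e : uniq (states_over e). Proof. exact: enum_uniq. Qed.

Definition rotate e : {perm state} := perm (can_inj (prev_next (states_over_uniq e))).

Lemma rotate_trans e s s' : s \in states_over e -> s' \in states_over e ->
  exists k, (rotate e ^+ k) s = s'.
Proof.
move=> se s'e; have cyc := cycle_next (states_over_uniq e).
have := fconnect_cycle cyc se s'; rewrite s'e => /iter_findex.
set k := findex _ _ _ => <-; exists k.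
elim: k => [|k IHk]; first by rewrite expg0 perm1.
by rewrite expgSr permM IHk permE.
Qed.

(** * The coset graph and its blocks *)

Section Cosets.
Variables (gT : finGroupType) (t : {set colour} -> gT) (pi : gT -> {perm state}) (s0 : state).
Hypothesis pi_M : {morph pi : x y / x * y}.
Hypothesis pi_t : forall e, pi (t e) = rotate e.
Hypothesis s0_valid : valid s0.

Definition block g : state := pi g s0.
Definition corner g c : colour * {set gT} := (c, g *: gen t (star c)).

(* Pairs (c, S) where S is not a coset are isolated vertices. *)
Definition host_adj : rel (colour * {set gT}) := fun x y => radj x.1 y.1 &&
  [exists g, [&& valid (block g), x == corner g x.1, y == corner g y.1,
                 x.1 \in codom (block g) & y.1 \in codom (block g)]].

Lemma host_sym : symmetric host_adj.
Proof.
move=> x y; rewrite /host_adj radj_sym; congr (_ && _); apply: eq_existsb => g.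
by case: (valid _) => //=; do !bool_congr.
Qed.

Lemma host_irrefl : irreflexive host_adj.
Proof. by move=> x; rewrite /host_adj /radj eqxx. Qed.

Definition host := SGraph host_sym host_irrefl.

Definition kept : rel host := fun x y => [exists g, valid (block g) &&
  [exists p, exists q, [&& p != q, ~~ @adj F p q, x == corner g (block g p) &
                           y == corner g (block g q)]]].

Lemma keptP x y : reflect (exists g p q, [/\ valid (block g), p != q, ~~ @adj F p q,
   x = corner g (block g p) & y = corner g (block g q)]) (kept x y).
Proof.
apply: (iffP existsP) => [[g /andP[vg /existsP[p /existsP[q /and4P[pq npq /eqP-> /eqP->]]]]]|].
  by exists g, p, q.
case=> g [p [q [vg pq npq -> ->]]]; exists g; rewrite vg.
by apply/existsP; exists p; apply/existsP; exists q; rewrite pq npq !eqxx.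
Qed.

Lemma kept_sym : symmetric kept.
Proof.
suff imp x y : kept x y -> kept y x by move=> x y; apply/idP/idP; apply: imp.
case/keptP=> g [p [q [vg pq npq xE yE]]]; apply/keptP; exists g, q, p.
by rewrite eq_sym adj_sym.
Qed.

Lemma corner_inj g : valid (block g) -> injective (fun p => corner g (block g p)).
Proof. by move=> vg p q [/(valid_inj vg)]. Qed.

Lemma host_adj_corner g p q : valid (block g) ->
  host_adj (corner g (block g p)) (corner g (block g q)) = @adj F p q.
Proof.
move=> vg; have [->|pq] := eqVneq p q; first by rewrite host_irrefl adj_irrefl.
rewrite /host_adj /= (validP _ vg _ _ pq).2; apply: andb_idr => _.
by apply/existsP; exists g; rewrite vg !eqxx !codom_f.
Qed.

Lemma kept_neq x y : kept x y -> x != y.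
Proof.
by case/keptP=> g [p [q [vg pq npq -> ->]]]; rewrite (inj_eq (corner_inj vg)).
Qed.

Lemma kept_nonadj x y : kept x y -> ~~ @adj host x y.
Proof. by case/keptP=> g [p [q [vg pq npq -> ->]]]; rewrite /= host_adj_corner. Qed.

(** The colours of [x] and [y] form an open pair [e], which some valid state takes as the values of
    [a] and [b]. A power of [t e] leads to a block with that state, and it fixes both corners since
    [e] lies at both colours. *)
Lemma kept_filled x y : kept x y -> exists g, [/\ valid (block g),
  x = corner g (block g a) & y = corner g (block g b)].
Proof.
case/keptP=> g [p [q [vg pq npq -> ->]]].
have [pq1 rpq] := validP _ vg _ _ pq; rewrite -rpq in npq.
have [s [vs sa sb]] := extend_state pq1 npq.
pose e := [set block g p; block g q].
have [||k gk] := @rotate_trans e (block g) s.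
- rewrite mem_enum inE vg; apply/subsetP=> c; rewrite !inE.
  by case/orP=> /eqP->; apply: codom_f.
- rewrite mem_enum inE vs; apply/subsetP=> c; rewrite !inE -sa -sb.
  by case/orP=> /eqP->; apply: codom_f.
pose g' := g * t e ^+ k; have bg' : block g' = s.
  rewrite /block /g' pi_M permM -gk; congr (fun_of_perm _ _).
  elim: k {gk g'} => [|k IHk].
    apply: (mulgI (pi 1)); rewrite -pi_M !mulg1 //.
  by rewrite !expgSr pi_M IHk pi_t.
have open_e : open_pair e.
  by apply/existsP; exists (block g p); apply/existsP; exists (block g q); rewrite pq1 npq eqxx.
have cornerE c : c \in e -> corner g' c = corner g c.
  move=> ce; congr (_, _); rewrite /g' lcosetM lcoset_id //.
  by rewrite groupX // gen_letter // inE open_e.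
by exists g'; rewrite bg' sa sb !cornerE ?inE ?eqxx ?orbT.
Qed.

Lemma kept_exists : exists x y, x != y /\ kept x y.
Proof.
have pi1 : pi 1 = 1 by apply: (mulgI (pi 1)); rewrite -pi_M !mulg1.
have ab_neq : a != b by apply: contraTneq ab => ->; rewrite adj_irrefl.
pose x := corner 1 (block 1 a); pose y := corner 1 (block 1 b).
have kxy : kept x y.
  apply/keptP; exists 1, a, b; split; rewrite // /block ?pi1 ?perm1 //.
  by rewrite /= /del_edge_adj eqxx andbF.
by exists x, y; rewrite kept_neq.
Qed.

(** The pair is the pair [a], [b] of some block. All other nonedges of this block are kept, hence
    still absent, so the block becomes an induced [H]. *)
Lemma kept_host (e : rel host) (e_sym : symmetric e) (e_irr : irreflexive e) :
  (forall u v, @adj host u v -> e u v) -> (forall u v, kept u v -> ~~ e u v) ->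
  forall u v : SGraph e_sym e_irr, u != v -> kept u v -> embeds H (add_edge u v).
Proof.
move=> sub_e keptN u v _ /kept_filled[g [vg uE vE]].
apply/embedsP; exists (fun p => corner g (block g p)); first exact: corner_inj.
move=> p q; have [->|pq] := eqVneq p q; first by rewrite !adj_irrefl.
have cI := corner_inj vg; rewrite /= /add_edge_adj (inj_eq cI) pq /=.
have -> : ([set corner g (block g p); corner g (block g q)] == [set u; v]) =
          ([set p; q] == [set a; b]).
  rewrite uE vE -!(imset_set1 (fun p => corner g (block g p))) -!imsetU.
  by rewrite (inj_eq (imset_inj cI)).
have : e (corner g (block g p)) (corner g (block g q)) = @adj F p q.
  have [Fpq|nFpq] := boolP (@adj F p q).
    by apply: sub_e; rewrite /= host_adj_corner.
  by apply/negbTE/keptN/keptP; exists g, p, q.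
move=> ->; rewrite /= /del_edge_adj; case: eqP => [pqab|_] /=; last by rewrite andbT orbF.
rewrite orbT; have : p \in [set a; b] by rewrite -pqab set21.
have : q \in [set a; b] by rewrite -pqab set22.
rewrite !inE => /orP[]/eqP qE /orP[]/eqP pE; subst p q; rewrite ?eqxx // in pq *.
  by rewrite adj_sym ab.
Qed.

Variables (C : {set H}) (N K : nat).
Notation U := (induced C).
Hypothesis cap_t : forall c c',
  gen t (star c) :&: gen t (star c') \subset gen t (star c :&: star c').
Hypothesis free_t : forall L : seq ({set colour} * gT), 0 < size L -> size L <= K.+1 ->
  {in L, forall p, [/\ exists x, p.1 \in star x, p.2 \in <[t p.1]> & p.2 != 1]} ->
  sorted (fun p q => p.1 != q.1) L -> \prod_(p <- L) p.2 != 1.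
Hypothesis cycle_t : forall m (c : nat -> colour) (g : nat -> gT), 2 < m -> m <= N.+1 ->
  (forall i, i < m -> g i \in gen t (star (c i))) ->
  (forall i, i.+1 < m -> c i != c i.+1) ->
  \prod_(i <- iota 0 m) g i = 1 ->
  exists i, [/\ 0 < i, i.+1 < m & g i \in gen t (star (c i.-1) :&: star (c i)) *
                                    gen t (star (c i) :&: star (c i.+1))].
Hypotheses (card_C : #|U| <= N) (leNK : N.*2 <= K.+1).
Hypotheses (C_connected : connected U) (C_no_cut : ~ has_cut_vertex U).
Hypothesis C_no_two_cut : ~ has_nonadjacent_two_cut U.
Hypothesis F_free : ~~ embeds U F.

(** Otherwise [U] would be a single vertex, which embeds in [F]. *)
Lemma C_neighbour (s : U) : exists r : U, adj s r.
Proof.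
have [r sr|iso] := pickP (fun r : U => adj s r); first by exists r.
have single r : r = s.
  have /connectP[[|v p] /= path_p rE] := C_connected.2 s r; first by [].
  by have /negP[] := negbT (iso v); case/andP: path_p.
have /negP[] := F_free; apply/embedsP; exists (fun=> a : F) => [x y _|x y].
  by rewrite (single x) (single y).
by rewrite (single x) (single y) !adj_irrefl.
Qed.

(** By [common_meet] the cosets of a copy of [U] share an element [g] at which all its edges are
    realised. The copy then lies in the block at [g], which is a copy of [F]. *)
Lemma host_C_free : ~~ embeds U host.
Proof.
apply/negP=> /embedsP[f f_inj fP].
have f_coset s : exists g, f s = corner g (f s).1.
  have [r] := C_neighbour s; rewrite -fP => /andP[_ /existsP[g /and5P[_ /eqP sE _ _ _]]].
  by exists g.
pose col s := (f s).1; pose rep s := repr (f s).2.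
have cellE s : cell star t col rep s = (f s).2.
  have [g fE] := f_coset s; rewrite /cell /rep /col fE /=.
  by apply/lcoset_eqP; apply: (mem_repr g); apply: lcoset_refl.
have same s r x : col s = col r -> x \in cell star t col rep s ->
    x \in cell star t col rep r -> s = r.
  rewrite !cellE /col => ec; have [g fs] := f_coset s; have [h fr] := f_coset r.
  move=> xs xr; apply: f_inj; rewrite fs fr -ec /corner; congr (_, _).
  rewrite fs in xs; rewrite fr -ec in xr.
  by rewrite -(lcoset_eqP xs) -(lcoset_eqP xr).
have adjc s r : adj s r -> [/\ cell star t col rep s :&: cell star t col rep r != set0,
    star (col s) :&: star (col r) = set0 & col s != col r].
  rewrite -fP => /andP[rsr /existsP[g /and5P[_ /eqP sE /eqP rE _ _]]]; split.
  - by apply/set0Pn; exists g; rewrite !cellE sE rE inE !lcoset_refl.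
  - exact: star_radj.
  - by apply: contraTneq rsr => e; rewrite /col in e; rewrite e /radj eqxx.
have [g meet] := common_meet star_simple star_line cap_t free_t cycle_t same adjc
  card_C leNK C_connected C_no_cut C_no_two_cut.
have at_g s : [/\ valid (block g), f s = corner g (f s).1 & (f s).1 \in codom (block g)].
  have [r asr] := C_neighbour s; have := asr; rewrite -fP.
  case/andP=> _ /existsP[h /and5P[vh /eqP sE /eqP rE cs _]].
  (* The element witnessing an edge lies in both of its cosets. *)
  have <- // : h = g.
  by apply: meet asr _ _; rewrite cellE; [rewrite sE | rewrite rE]; apply: lcoset_refl.
have pre s : exists p, block g p = (f s).1.
  by have [_ _ cs] := at_g s; exists (iinv cs); apply: f_iinv.
have [h hE] := fin_all_exists pre; have [c0 _] := card_gt0P C_connected.1.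
have vg : valid (block g) by case: (at_g c0).
have fE s : f s = corner g (block g (h s)) by rewrite hE; case: (at_g s).
have /negP[] := F_free; apply/embedsP; exists h.
  by move=> s r e; apply: f_inj; rewrite !fE e.
by move=> s r; rewrite -fP !fE -(host_adj_corner _ _ vg).
Qed.

End Cosets.
End Colours.

Theorem theorem4p5 (H : sgraph) (C : {set H})
  (C_connected : connected (induced C))
  (C_no_cut_vertex : ~ has_cut_vertex (induced C))
  (C_no_two_cut : ~ has_nonadjacent_two_cut (induced C))
  (e0 : exists u v : H, adj u v /\ ~ contains_induced (induced C) (del_edge u v)) :
  exists J : sgraph, addition_host H J.
Proof.
case: e0 => a [b [ab F_free]].
have F_free' : ~~ embeds (induced C) (del_edge a b).
  by apply/negP=> /contains_inducedP.
pose N := #|induced C|; pose K := N.*2.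
have ab_neq : a != b by apply: contraTneq ab => ->; rewrite adj_irrefl.
(* Any valid state will do; two colours with all bits false are not adjacent. *)
have [s0 [s0_valid _ _]] : exists s,
    [/\ valid a b s, s a = (a, [ffun=> false]) & s b = (b, [ffun=> false])].
  by apply: extend_state; rewrite // /radj /= ab_neq !ffunE.
have [gT [t [pi [[pi_M pi_t] cap_t free_t cycle_t]]]] :=
  acyclic_group (rotate a b) N K (@star_line H) (@star_simple H).
apply: (@saturation H (host a b t pi s0) (@kept H a b gT t pi s0)).
- exact: kept_sym.
- exact: kept_exists.
- exact: kept_nonadj.
- have := host_C_free pi s0 cap_t free_t cycle_t (leqnn _) (leqnSn _) C_connected
    C_no_cut_vertex C_no_two_cut F_free'.
  (* An induced [H] would contain an induced [C]. *)
  apply: contra; apply: embeds_trans; apply/embedsP; exists val; first exact: val_inj.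
  by [].
- exact: kept_host.
Qed.
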